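(* Let $(\Lambda,\le)$ be a directed poset, let $(X,\mu)$ be a measure space of the type described in the context, and for each $p\in X$ let $\{\mathcal{H}_p;\ \mathcal{E}_p=\{\mathcal{H}_{\alpha,p}\}_{\alpha\in\Lambda};\ \mathcal{D}_p\}$ be a quantized domain. Suppose that either $\Lambda$ is a countable set or $\mu$ is a counting measure on $X$. Then the algebra $C^*_{\mathcal{E},\mathrm{DEC}}\left(\int^{\oplus_{\mathrm{loc}}}_{X_{\mathrm{loc}}}\mathcal{D}_p\,d\mu(p)\right)$ of decomposable locally bounded operators is a locally von Neumann algebra.
   Context: **Measure space.** $X$ is a $\sigma$-compact locally compact space and $\mu$ is the completion of a positive Borel measure on $X$. **Strictly inductive system, locally Hilbert space, quantized domain.** Let $(\Lambda,\le)$ be a directed poset. A family $\mathcal{F}=\{\mathcal{H}_\alpha\}_{\alpha\in\Lambda}$ of Hilbert spaces is a strictly inductive system if, whenever $\alpha\le\beta$, $\mathcal{H}_\alpha\subseteq\mathcal{H}_\beta$ and the inclusion is isometric. Its inductive limit is $\mathcal{D}=\bigcup_{\alpha\in\Lambda}\mathcal{H}_\alpha$, called a locally Hilbert space. A quantized domain $\{\mathcal{H};\mathcal{F}=\{\mathcal{H}_\alpha\}_{\alpha\in\Lambda};\mathcal{D}\}$ consists of a strictly inductive system $\mathcal{F}$, the locally Hilbert space $\mathcal{D}=\bigcup_\alpha\mathcal{H}_\alpha$, and the Hilbert space $\mathcal{H}=\overline{\mathcal{D}}$ which is the completion of $\mathcal{D}$. **Locally bounded operators.** $C^*_{\mathcal{F}}(\mathcal{D})$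 is the set of linear operators $T:\mathcal{D}\to\mathcal{D}$ such that for each $\alpha\in\Lambda$: $T(\mathcal{H}_\alpha)\subseteq\mathcal{H}_\alpha$, $T(\mathcal{H}_\alpha^\perp\cap\mathcal{D})\subseteq\mathcal{H}_\alpha^\perp\cap\mathcal{D}$, and $T|_{\mathcal{H}_\alpha}\in\mathcal{B}(\mathcal{H}_\alpha)$. It is a unital $*$-algebra, where $T^*$ is the restriction to $\mathcal{D}$ of the (unbounded) Hilbert space adjoint; equivalently $T^*|_{\mathcal{H}_\alpha}=(T|_{\mathcal{H}_\alpha})^*$ for each $\alpha$. It carries the locally convex topology generated by the $C^*$-seminorms $T\mapsto\|T|_{\mathcal{H}_\alpha}\|$, $\alpha\in\Lambda$; subalgebras carry the induced topology. **Locally von Neumann algebra.** A projective system of von Neumann algebras consists of von Neumann algebras $\{\mathcal{M}_\alpha\}_{\alpha\in\Lambda}$ indexed by a directed poset and normal $*$-homomorphisms $\phi_{\alpha,\beta}:\mathcal{M}_\beta\to\mathcal{M}_\alpha$ for $\alpha\le\beta$ with $\phi_{\alpha,\alpha}=\mathrm{id}$ and $\phi_{\alpha,\beta}\circ\phi_{\beta,\gamma}=\phi_{\alpha,\gamma}$ for $\alpha\le\beta\le\gamma$. Its projective limit is $\{(x_\alpha)\in\prod_\alpha\mathcal{M}_\alpha:\phi_{\alpha,\beta}(x_\beta)=x_\alpha\text{ for }\alpha\le\beta\}$ with the weakest locally convex topology making all coordinate maps continuous (norm topology on each $\mathcal{M}_\alpha$). A locally von Neumann algebra is an algebra that is (up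 to isomorphism of topological $*$-algebras) the projective limit of some projective system of von Neumann algebras. **Direct integral of Hilbert spaces.** Let $\{\mathcal{K}_p\}_{p\in X}$ be a family of separable Hilbert spaces. A separable Hilbert space $\mathcal{K}$ is the direct integral of $\{\mathcal{K}_p\}$ over $(X,\mu)$, written $\mathcal{K}=\int_X^\oplus\mathcal{K}_p\,d\mu(p)$, when to each $x\in\mathcal{K}$ there corresponds a function $p\mapsto x(p)$ on $X$ with $x(p)\in\mathcal{K}_p$ for each $p$, such that: (1) $p\mapsto\langle x(p),y(p)\rangle$ is $\mu$-integrable for all $x,y\in\mathcal{K}$ and $\langle x,y\rangle=\int_X\langle x(p),y(p)\rangle\,d\mu(p)$; (2) if $x_p\in\mathcal{K}_p$ for all $p\in X$ and $p\mapsto\langle x_p,y(p)\rangle$ is integrable for each $y\in\mathcal{K}$, then there is $x\in\mathcal{K}$ with $x(p)=x_p$ for $\mu$-a.e. $p$. **Standing setting.** All $\mathcal{H}_p$ (hence all $\mathcal{H}_{\alpha,p}$) are separable, and the direct integrals $\int_X^\oplus\mathcal{H}_{\alpha,p}\,d\mu(p)$ ($\alpha\in\Lambda$) and $\int_X^\oplus\mathcal{H}_p\,d\mu(p)$ are given. For $\alpha\le\beta$ one has $\int_X^\oplus\mathcal{H}_{\alpha,p}\,d\mu(p)\subseteq\int_X^\oplus\mathcal{H}_{\beta,p}\,d\mu(p)\subseteq\int_X^\oplus\mathcal{H}_p\,d\mu(p)$, coming from $\mathcal{H}_{\alpha,p}\subseteq\mathcal{H}_{\beta,p}\subseteq\mathcal{H}_p$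 (an element keeps the same function $p\mapsto x(p)$, up to a.e. equality). Put $\mathcal{E}=\{\int_X^\oplus\mathcal{H}_{\alpha,p}\,d\mu(p)\}_{\alpha\in\Lambda}$, a strictly inductive system, and $$\int^{\oplus_{\mathrm{loc}}}_{X_{\mathrm{loc}}}\mathcal{D}_p\,d\mu(p):=\bigcup_{\alpha\in\Lambda}\int_X^\oplus\mathcal{H}_{\alpha,p}\,d\mu(p),$$ the direct integral of the locally Hilbert spaces $\mathcal{D}_p$. **Decomposable locally bounded operators.** $T\in C^*_{\mathcal{E}}\left(\int^{\oplus_{\mathrm{loc}}}_{X_{\mathrm{loc}}}\mathcal{D}_p\,d\mu(p)\right)$ is decomposable if there is a family $\{T_p\in C^*_{\mathcal{E}_p}(\mathcal{D}_p)\}_{p\in X}$ such that for every $u\in\int^{\oplus_{\mathrm{loc}}}_{X_{\mathrm{loc}}}\mathcal{D}_p\,d\mu(p)$, $(Tu)(p)=T_pu(p)$ for a.e. $p\in X$. The set of all decomposable operators is denoted $C^*_{\mathcal{E},\mathrm{DEC}}\left(\int^{\oplus_{\mathrm{loc}}}_{X_{\mathrm{loc}}}\mathcal{D}_p\,d\mu(p)\right)$; it is a $*$-subalgebra of $C^*_{\mathcal{E}}\left(\int^{\oplus_{\mathrm{loc}}}_{X_{\mathrm{loc}}}\mathcal{D}_p\,d\mu(p)\right)$. *)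

(* Defs.v *)
From HB Require Import structures.
From mathcomp Require Import all_boot all_order all_algebra.
From mathcomp Require Import complex.
From mathcomp Require Import all_classical all_reals all_analysis.
From mathcomp Require Import measurable_realfun.

Set Implicit Arguments.
Unset Strict Implicit.
Unset Printing Implicit Defensive.

Import Order.TTheory GRing.Theory Num.Theory.
Import numFieldNormedType.Exports.

Local Open Scope classical_set_scope.
Local Open Scope ring_scope.

HB.mixin Record isDirected (d : Order.disp_t) T & Order.POrder d T := {
  directed_inhabited : inhabited T;
  directed_ub : forall x y : T, exists z : T, (x <= z)%O /\ (y <= z)%O
}.

#[short(type="directedType")]
HB.structure Definition Directed (d : Order.disp_t) :=
  {T of Order.POrder d T & isDirected d T}.

(* The inner product is linear in its first argument. *)
HB.mixin Record isHilbert (R : realType) V & CompleteNormedModule R[i] V := {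
  dotp : V -> V -> R[i];
  dotp_linear : forall z x y (k : R[i]),
    dotp (k *: x + y) z = k * dotp x z + dotp y z;
  dotp_conj : forall x y, dotp x y = (dotp y x)^*;
  dotp_norm : forall x, dotp x x = `|x| ^+ 2
}.

#[short(type="hilbertType")]
HB.structure Definition Hilbert (R : realType) :=
  {V of CompleteNormedModule R[i] V & isHilbert R V}.

Notation "''<<' x , y '>>'" := (dotp x y)
  (at level 0, x, y at level 99, format "''<<' x ,  y '>>'") : ring_scope.

Definition separable (T : topologicalType) :=
  exists2 B : set T, countable B & dense B.

Definition sigma_compact (T : topologicalType) :=
  exists2 F : nat -> set T, (forall n, compact (F n)) & \bigcup_n F n = setT.

Definition perp (R : realType) (H : hilbertType R) (A : set H) : set H :=
  [set x | forall y, A y -> '<<x, y>> = 0].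

Section BoundedOperators.
Variables (R : realType) (G : hilbertType R).
Implicit Types (T S : G -> G) (M : set (G -> G)) (F : set_system (G -> G)).

Definition bounded_op : set (G -> G) :=
  [set T | linear T /\ exists C : R[i], forall x, `|T x| <= C * `|x|].

Definition opnorm T : R :=
  sup [set complex.Re `|T x| | x in [set x | `|x| <= 1]].

Definition is_adjoint T S := forall x y, '<<T x, y>> = '<<x, S y>>.

Definition wot_cvg F T :=
  forall x y, (fun S => '<<S x, y>>) @ F --> ('<<T x, y>> : R[i]^o).

Definition wot_closed M := forall F, ProperFilter F -> F M ->
  forall T, bounded_op T -> wot_cvg F T -> M T.

Record von_neumann_algebra M : Prop := VonNeumannAlgebra {
  vN_bounded : M `<=` bounded_op;
  vN_id : M id;
  vN_lin : forall (k : R[i]) T S, M T -> M S -> M (k *: T + S);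
  vN_comp : forall T S, M T -> M S -> M (T \o S);
  vN_adj : forall T, M T -> exists2 S, M S & is_adjoint T S;
  vN_closed : wot_closed M
}.

Definition square_summable (x : nat -> G) :=
  cvgn (series (fun n => complex.Re `|x n| ^+ 2)).

(* The vector functional T |-> \sum_n <T x_n, y_n>, for square-summable x and
   y; these functionals generate the sigma-weak topology. *)
Definition sigma_weak_form (x y : nat -> G) T : R[i]^o :=
  limn (series (fun n => '<<T (x n), y n>> : R[i]^o)).

Definition sigma_weak_cvg F T :=
  forall x y, square_summable x -> square_summable y ->
    sigma_weak_form x y @ F --> sigma_weak_form x y T.

End BoundedOperators.

(* phi is only relevant on M; normality is continuity of phi : M -> N for the
   sigma-weak topologies, expressed by convergence of filters living on M. *)
Record normal_star_hom (R : realType) (G1 G2 : hilbertType R)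
    (M : set (G1 -> G1)) (N : set (G2 -> G2))
    (phi : (G1 -> G1) -> (G2 -> G2)) : Prop := NormalStarHom {
  nsh_maps : forall T, M T -> N (phi T);
  nsh_lin : forall (k : R[i]) T S, M T -> M S ->
    phi (k *: T + S) = k *: phi T + phi S;
  nsh_comp : forall T S, M T -> M S -> phi (T \o S) = phi T \o phi S;
  nsh_adj : forall T S, M T -> M S ->
    is_adjoint T S -> is_adjoint (phi T) (phi S);
  nsh_normal : forall F : set_system (G1 -> G1), ProperFilter F -> F M ->
    forall T, M T -> sigma_weak_cvg F T -> sigma_weak_cvg (phi @ F) (phi T)
}.

Record vN_system (R : realType) (d : Order.disp_t) (I : directedType d) :=
  VNSystem {
  vs_space : I -> hilbertType R;
  vs_alg : forall i, set (vs_space i -> vs_space i);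
  (* the connecting map phi_{i,j} : M_j -> M_i *)
  vs_map : forall i j : I,
    (vs_space j -> vs_space j) -> (vs_space i -> vs_space i);
  vs_vN : forall i, von_neumann_algebra (@vs_alg i);
  vs_normal : forall i j, (i <= j)%O ->
    normal_star_hom (@vs_alg j) (@vs_alg i) (@vs_map i j);
  vs_id : forall i T, @vs_alg i T -> @vs_map i i T = T;
  vs_trans : forall i j k, (i <= j)%O -> (j <= k)%O ->
    forall T, @vs_alg k T -> @vs_map i j (@vs_map j k T) = @vs_map i k T
}.

Arguments vs_alg {R d I} v i.
Arguments vs_map {R d I} v i j.

Definition proj_limit (R : realType) (d : Order.disp_t) (I : directedType d)
    (S : vN_system R I) : set (forall i, vs_space S i -> vs_space S i) :=
  [set x | (forall i, vs_alg S i (x i)) /\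
           forall i j, (i <= j)%O -> vs_map S i j (x j) = x i].

(* A strictly inductive system of Hilbert spaces, realized as an increasing
   family of closed subspaces of an ambient Hilbert space. *)
Record ind_system (R : realType) (d : Order.disp_t) (L : directedType d)
    (H : hilbertType R) := IndSystem {
  ind_space :> L -> set H;
  ind_space0 : forall a, ind_space a 0;
  ind_spaceP : forall a (k : R[i]) x y,
    ind_space a x -> ind_space a y -> ind_space a (k *: x + y);
  ind_closed : forall a, closed (ind_space a);
  ind_mono : forall a b, (a <= b)%O -> ind_space a `<=` ind_space b
}.

Section LocallyHilbert.
Variables (R : realType) (d : Order.disp_t) (L : directedType d).
Variables (H : hilbertType R) (E : ind_system L H).

Definition ind_union : set H := \bigcup_a E a.

Definition in_union : pred H := fun x => `[< ind_union x >].

Lemma in_union_submod : submod_closed in_union.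
Proof.
split=> [|k x y /asboolP[a _ xa] /asboolP[b _ yb]]; apply/asboolP.
  by case: (@directed_inhabited _ L) => a; exists a => //; exact: ind_space0.
have [c [ac bc]] := @directed_ub _ L a b.
by exists c => //; apply: ind_spaceP; [exact: (ind_mono ac)|exact: (ind_mono bc)].
Qed.

HB.instance Definition _ := GRing.isSubmodClosed.Build R[i] H in_union
  in_union_submod.

Record locHilbert := LocHilbert {
  lh_val :> H;
  lh_valP : lh_val \in in_union
}.

HB.instance Definition _ := [isSub for lh_val].
HB.instance Definition _ := [Choice of locHilbert by <:].
HB.instance Definition _ := [SubChoice_isSubLmodule of locHilbert by <:].

Implicit Types (T S : locHilbert -> locHilbert).

Definition loc_bounded_op : set (locHilbert -> locHilbert) :=
  [set T | linear T /\ forall a,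
    [/\ forall u, E a (lh_val u) -> E a (lh_val (T u)),
        forall u, perp (E a) (lh_val u) -> perp (E a) (lh_val (T u)) &
        exists C : R[i], forall u, E a (lh_val u) ->
          `|lh_val (T u)| <= C * `|lh_val u| ]].

Definition loc_seminorm a T : R :=
  sup [set complex.Re `|lh_val (T u)| |
       u in [set u | E a (lh_val u) /\ `|lh_val u| <= 1]].

Definition loc_adjoint T S :=
  forall u v, '<<lh_val (T u), lh_val v>> = '<<lh_val u, lh_val (S v)>>.

(* Phi is an isomorphism of topological *-algebras from A onto the projective
   limit of S. Both topologies are given by seminorms, and are described by
   the filters that converge for them. *)
Record loc_vN_iso (A : set (locHilbert -> locHilbert))
    (d' : Order.disp_t) (I : directedType d') (S : vN_system R I)
    (Phi : (locHilbert -> locHilbert) ->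
           forall i, vs_space S i -> vs_space S i) : Prop := LocVNIso {
  lvi_bij : set_bij A (@proj_limit R d' I S) Phi;
  lvi_lin : forall (k : R[i]) T U, A T -> A U ->
    forall i, Phi (k *: T + U) i = k *: Phi T i + Phi U i;
  lvi_comp : forall T U, A T -> A U ->
    forall i, Phi (T \o U) i = Phi T i \o Phi U i;
  lvi_adj : forall T U, A T -> A U ->
    loc_adjoint T U <-> forall i, is_adjoint (Phi T i) (Phi U i);
  lvi_top : forall F : set_system (locHilbert -> locHilbert),
    ProperFilter F -> F A -> forall T, A T ->
    (forall a, (fun U => loc_seminorm a (U - T)) @ F --> (0 : R)) <->
    (forall i, (fun U => opnorm (Phi U i - Phi T i)) @ F --> (0 : R))
}.

End LocallyHilbert.

Definition loc_von_neumann_algebra (R : realType) (d : Order.disp_t)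
    (L : directedType d) (H : hilbertType R) (E : ind_system L H)
    (A : set (locHilbert E -> locHilbert E)) :=
  exists (d' : Order.disp_t) (I : directedType d') (S : vN_system R I) Phi,
    @loc_vN_iso R d L H E A d' I S Phi.

Record quantized_domain (R : realType) (d : Order.disp_t)
    (L : directedType d) := QuantizedDomain {
  qd_space :> hilbertType R;
  qd_sys : ind_system L qd_space;
  qd_dense : closure (ind_union qd_sys) = setT
}.

Section Measure.
Variables (R : realType) (X : ptopologicalType).

Definition borelType := g_sigma_algebraType (@open X).

HB.instance Definition _ := Measurable.on borelType.

Definition completedType (nu : {measure set borelType -> \bar R}) :=
  g_sigma_algebraType (completed_algebra_gen nu).

HB.instance Definition _ nu := Measurable.on (completedType nu).

(* A measure on the completed sigma-algebra that extends nu is the completion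
   of nu. *)
Definition is_completion (nu : {measure set borelType -> \bar R})
    (mu : {measure set (completedType nu) -> \bar R}) :=
  forall A : set X, measurable (A : set borelType) -> mu A = nu A.

Definition is_counting d (T : measurableType d)
    (mu : {measure set T -> \bar R}) :=
  forall A : set T, measurable A -> mu A = counting A.

End Measure.

Section DirectIntegral.
Context (R : realType) d (X : measurableType d).
Variable mu : {measure set X -> \bar R}.

Definition C_integrable (f : X -> R[i]) : Prop :=
  mu.-integrable setT (fun p => (complex.Re (f p))%:E) /\
  mu.-integrable setT (fun p => (complex.Im (f p))%:E).

Definition C_integral (f : X -> R[i]) : R[i] :=
  Complex (Rintegral mu setT (fun p => complex.Re (f p)))
          (Rintegral mu setT (fun p => complex.Im (f p))).

(* The closed subspace S of K is the direct integral of the closed subspaces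
   V p of H p, the function attached to x in S being p |-> ev x p. *)
Record direct_integral (H : X -> hilbertType R) (V : forall p, set (H p))
    (K : hilbertType R) (S : set K) (ev : K -> forall p, H p) : Prop :=
  DirectIntegral {
  di_fiber : forall x, S x -> forall p, V p (ev x p);
  di_integrable : forall x y, S x -> S y ->
    C_integrable (fun p => '<<ev x p, ev y p>>);
  di_dotp : forall x y, S x -> S y ->
    '<<x, y>> = C_integral (fun p => '<<ev x p, ev y p>>);
  di_complete : forall f : (forall p, H p), (forall p, V p (f p)) ->
    (forall y, S y -> C_integrable (fun p => '<<f p, ev y p>>)) ->
    exists2 x, S x & {ae mu, forall p, ev x p = f p}
}.

Context d' (L : directedType d') (Q : X -> quantized_domain R L).

(* ldi_space is the direct integral of the H_p, with ldi_ev x p = x(p), and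
   ldi_sys a is the direct integral of the H_{a,p}, with its own functions
   ldi_sev a x. *)
Record loc_direct_integral := LocDirectIntegral {
  ldi_space : hilbertType R;
  ldi_separable : separable ldi_space;
  ldi_ev : ldi_space -> forall p, Q p;
  ldi_full : direct_integral (H := Q) (fun p => setT) setT ldi_ev;
  ldi_sys : ind_system L ldi_space;
  ldi_sev : L -> ldi_space -> forall p, Q p;
  ldi_sub : forall a,
    direct_integral (H := Q) (fun p => qd_sys (Q p) a) (ldi_sys a) (ldi_sev a);
  ldi_sevE : forall a x, ldi_sys a x ->
    {ae mu, forall p, ldi_sev a x p = ldi_ev x p}
}.

Variable D : loc_direct_integral.

(* u(p) lies in D_p for almost every p only; the vector w is u(p) seen as an
   element of D_p. *)
Definition decomposable (T : locHilbert (ldi_sys D) -> locHilbert (ldi_sys D)) :=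
  exists2 Tp : (forall p, locHilbert (qd_sys (Q p)) ->
                          locHilbert (qd_sys (Q p))),
    (forall p, loc_bounded_op (Tp p)) &
    forall u, {ae mu, forall p, exists2 w : locHilbert (qd_sys (Q p)),
      lh_val w = ldi_ev (lh_val u) p &
      ldi_ev (lh_val (T u)) p = lh_val (Tp p w)}.

Definition decomposable_algebra :
    set (locHilbert (ldi_sys D) -> locHilbert (ldi_sys D)) :=
  [set T | loc_bounded_op T /\ decomposable T].

End DirectIntegral.

(* Main.v *)
(** For each [a], the direct integral of the [H_{a,p}] is a Hilbert space [G_a],
    and the operators on [G_a] that commute with multiplication by indicators of
    measurable sets and with the projections onto the [G_c], [c <= a], form a
    commutant, hence a von Neumann algebra [M_a]. Restriction maps [M_b] to
    [M_a] normally, and the decomposable algebra is the projective limit of the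
    [M_a] through [T |-> (T|_{G_a})_a]. The point is that every compatible family
    comes from a decomposable operator. Commuting with indicators gives, for a
    countable dense family [x_n] of [G_a], the pointwise bound
    [|(T x_m - T x_n)(p)| <= C |(x_m - x_n)(p)|] off a null set, so that
    [x_n(p) |-> (T x_n)(p)] extends to a bounded operator [t_{a,p}] of [H_{a,p}];
    commuting with projections makes [t_{b,p}] reduce [H_{a,p}], where it
    coincides with [t_{a,p}]. These relations hold off a null set for each pair
    [a <= b]; the operators [t_{a,p}] can be glued into an operator on [D_p] once
    they hold off one null set for all pairs, which is automatic when [L] is
    countable, and when [mu] is a counting measure since only the empty set is
    then null. *)
Require Import Defs.
From HB Require Import structures.
From mathcomp Require Import all_boot all_order all_algebra.
From mathcomp Require Import complex ring lra finmap.
From mathcomp Require Import all_classical all_reals all_analysis.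
From mathcomp Require Import measurable_realfun.

Set Implicit Arguments.
Unset Strict Implicit.
Unset Printing Implicit Defensive.

Import Order.TTheory GRing.Theory Num.Theory.
Import numFieldNormedType.Exports.

Local Open Scope classical_set_scope.
Local Open Scope ring_scope.

(** * Real-valued norms *)

Lemma Re_norm_ge0 (R : realType) (k : R[i]) : 0 <= complex.Re `|k|.
Proof. by rewrite -lecR RRe_real ?normr_real ?normr_ge0. Qed.

Section RealNorm.
Context {R : realType} {V : normedModType R[i]}.
Implicit Types (x y z : V) (k : R[i]).

(** The norm of a module over [R[i]] is itself an element of [R[i]]. Its real part is what infima,
    integrals and real arithmetic can be applied to. *)
Definition nrm x : R := complex.Re `|x|.

Lemma nrmE x : `|x| = (nrm x)%:C%C.
Proof. by rewrite /nrm RRe_real ?normr_real. Qed.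

Lemma nrm_ge0 x : 0 <= nrm x.
Proof. by rewrite -lecR -nrmE normr_ge0. Qed.

Lemma nrm0 : nrm 0 = 0.
Proof. by rewrite /nrm normr0. Qed.

Lemma nrm_eq0 x : nrm x = 0 -> x = 0.
Proof. by move=> h; apply/eqP; rewrite -normr_eq0 nrmE h. Qed.

Lemma nrmD x y : nrm (x + y) <= nrm x + nrm y.
Proof. by rewrite -lecR rmorphD /= -!nrmE ler_normD. Qed.

Lemma nrmN x : nrm (- x) = nrm x.
Proof. by rewrite /nrm normrN. Qed.

Lemma nrm_dist x y : nrm (x - y) = nrm (y - x).
Proof. by rewrite -nrmN opprB. Qed.

Lemma nrmZ k x : nrm (k *: x) = complex.Re `|k| * nrm x.
Proof.
by apply: complexI; rewrite rmorphM /= -!nrmE normrZ.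
Qed.

Lemma nrm_dist_trans z x y : nrm (x - y) <= nrm (x - z) + nrm (z - y).
Proof. by rewrite -{1}(subrK z x) -addrA nrmD. Qed.

Lemma eq_of_nrm x y : (forall e : R, 0 < e -> nrm (x - y) <= e) -> x = y.
Proof.
move=> h; apply/eqP; rewrite -subr_eq0; apply/eqP/nrm_eq0/eqP.
rewrite eq_le nrm_ge0 andbT; apply/ler_addgt0Pl => e e0; rewrite addr0; exact: h.
Qed.

Lemma ball_nrmE x (e : R) y : ball x e%:C%C y = (nrm (x - y) < e).
Proof. by rewrite -ball_normE /ball_ /= nrmE ltcR. Qed.

Lemma posC (e : R[i]) : 0 < e -> exists2 r : R, 0 < r & e = r%:C%C.
Proof.
move=> e0; exists (complex.Re e); last by rewrite RRe_real// gtr0_real.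
by rewrite -ltcR RRe_real ?gtr0_real.
Qed.

Lemma nbhs_nrm x (A : set V) :
  nbhs x A <-> exists2 e : R, 0 < e & forall y, nrm (x - y) < e -> A y.
Proof.
split=> [/nbhs_ballP[e /= /posC[r r0 ->] h]|[e e0 h]].
  by exists r => // y hy; apply: h; rewrite ball_nrmE.
apply/nbhs_ballP; exists e%:C%C => /=; first by rewrite ltcR.
by move=> y; rewrite ball_nrmE; exact: h.
Qed.

Definition adherent (B : set V) x := forall e : R, 0 < e ->
  exists2 y, B y & nrm (x - y) < e.

Lemma closure_adherent (B : set V) x : closure B x <-> adherent B x.
Proof.
split=> [h e e0|h A /nbhs_nrm[e e0 hA]].
  have [] := h [set y | nrm (x - y) < e]; last by move=> y []; exists y.
  by apply/nbhs_nrm; exists e.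
by have [y By xy] := h e e0; exists y; split => //; exact: hA.
Qed.

Lemma closed_adherent (B : set V) : closed B <-> forall x, adherent B x -> B x.
Proof.
split=> [cB x /closure_adherent|h x /closure_adherent]; last exact: h.
exact: cB.
Qed.

Lemma adherentS (A B : set V) x : A `<=` B -> adherent A x -> adherent B x.
Proof. by move=> AB h e /h[y /AB]; exists y. Qed.

Lemma adherent_adherent (A : set V) x : adherent (adherent A) x -> adherent A x.
Proof.
move=> h e e0; have e2 : 0 < e / 2 by rewrite divr_gt0.
have [y /(_ _ e2)[z Az yz] xy] := h _ e2.
exists z => //; apply: le_lt_trans (nrm_dist_trans y _ _) _.
by rewrite [e]splitr ltrD.
Qed.

End RealNorm.

(** A bound [C] may be any complex number. The inequality forces [C * |x|] to be a nonnegative real,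
    hence equal to its modulus, so the modulus of [C] is a bound too. *)
Lemma real_bound (R : realType) (V W : normedModType R[i]) (C : R[i]) :
  exists c : R, 0 <= c /\
    forall (x : V) (y : W), `|y| <= C * `|x| -> nrm y <= c * nrm x.
Proof.
have [c cE] : exists c : R, `|C| = c%:C%C.
  by exists (complex.Re `|C|); rewrite RRe_real ?normr_real.
exists c; split; first by rewrite -lecR -cE normr_ge0.
move=> x y h; rewrite -lecR rmorphM /= -!nrmE -cE.
by rewrite -[X in _ * X]normr_id -normrM ger0_norm// (le_trans _ h).
Qed.

Section Complete.
Context {R : realType} {V : completeNormedModType R[i]}.

Lemma nrm_cauchy_cvg (u : nat -> V) :
  (forall e : R, 0 < e -> exists N, forall m n, (N <= m)%N -> (N <= n)%N ->
     nrm (u m - u n) < e) ->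
  exists l, forall e : R, 0 < e -> exists N, forall n, (N <= n)%N ->
     nrm (l - u n) < e.
Proof.
move=> h; have cu : cauchy (u @ \oo).
  apply/cauchy_ballP => _ /posC[e e0 ->].
  have [N hN] := h e e0.
  exists ([set u n | n in [set n | (N <= n)%N]], [set u n | n in [set n | (N <= n)%N]]).
    by split; exists N => // n /= Nn; exists n.
  by move=> [_ _] [/= [m Nm <-] [n Nn <-]]; rewrite ball_nrmE; exact: hN.
have ul := cauchy_cvg _ cu; exists (lim (u @ \oo)) => e e0.
have /ul : nbhs (lim (u @ \oo)) [set y | nrm (lim (u @ \oo) - y) < e].
  by apply/nbhs_nrm; exists e.
by move=> -[N _ hN]; exists N => n Nn; apply: hN.
Qed.

End Complete.

(** * Inner products and orthogonal projections *)

Section InnerProduct.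
Context {R : realType} {H : hilbertType R}.
Implicit Types (x y z : H) (k : R[i]) (A : set H).

Lemma dotpZDl k x y z : '<<k *: x + y, z>> = k * '<<x, z>> + '<<y, z>>.
Proof. exact: dotp_linear. Qed.

Lemma dot0p z : '<<(0 : H), z>> = 0.
Proof.
have := dotpZDl 1 0 0 z; rewrite scale1r addr0 mul1r => /eqP.
by rewrite -subr_eq0 opprD addrA subrr sub0r oppr_eq0 => /eqP.
Qed.

Lemma dotpDl x y z : '<<x + y, z>> = '<<x, z>> + '<<y, z>>.
Proof. by have := dotpZDl 1 x y z; rewrite scale1r mul1r. Qed.

Lemma dotpZl k x z : '<<k *: x, z>> = k * '<<x, z>>.
Proof. by have := dotpZDl k x 0 z; rewrite addr0 dot0p addr0. Qed.

Lemma dotpNl x z : '<<- x, z>> = - '<<x, z>>.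
Proof. by rewrite -scaleN1r dotpZl mulN1r. Qed.

Lemma dotpBl x y z : '<<x - y, z>> = '<<x, z>> - '<<y, z>>.
Proof. by rewrite dotpDl dotpNl. Qed.

Lemma dotp0 z : '<<z, (0 : H)>> = 0.
Proof. by rewrite dotp_conj dot0p rmorph0. Qed.

Lemma dotpDr x y z : '<<z, x + y>> = '<<z, x>> + '<<z, y>>.
Proof. by rewrite dotp_conj dotpDl rmorphD/= -!dotp_conj. Qed.

Lemma dotpZr k x z : '<<z, k *: x>> = k^* * '<<z, x>>.
Proof. by rewrite dotp_conj dotpZl rmorphM/= -!dotp_conj. Qed.

Lemma dotpNr x z : '<<z, - x>> = - '<<z, x>>.
Proof. by rewrite dotp_conj dotpNl rmorphN/= -!dotp_conj. Qed.

Lemma dotpBr x y z : '<<z, x - y>> = '<<z, x>> - '<<z, y>>.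
Proof. by rewrite dotpDr dotpNr. Qed.

Lemma dotpp x : '<<x, x>> = (nrm x ^+ 2)%:C%C.
Proof. by rewrite dotp_norm nrmE rmorphXn. Qed.

Lemma dotpp_eq0 x : '<<x, x>> = 0 -> x = 0.
Proof.
rewrite dotpp => /(@complexI R (nrm x ^+ 2) 0)/eqP.
by rewrite sqrf_eq0 => /eqP/nrm_eq0.
Qed.

Lemma dotp_ext x y : (forall z, '<<x, z>> = '<<y, z>>) -> x = y.
Proof.
by move=> h; apply/eqP; rewrite -subr_eq0; apply/eqP/dotpp_eq0; rewrite dotpBl h subrr.
Qed.

Lemma Re_dotpC x y : complex.Re '<<x, y>> = complex.Re '<<y, x>>.
Proof. by rewrite dotp_conj; case: '<<y, x>>. Qed.

Lemma dotpC_eq0 x y : '<<x, y>> = 0 -> '<<y, x>> = 0.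
Proof. by move=> h; rewrite dotp_conj h rmorph0. Qed.

Lemma sqr_nrmD x y :
  nrm (x + y) ^+ 2 = nrm x ^+ 2 + nrm y ^+ 2 + 2 * complex.Re '<<x, y>>.
Proof.
have -> : nrm (x + y) ^+ 2 = complex.Re '<<x + y, x + y>> by rewrite dotpp.
rewrite dotpDl !dotpDr !dotpp !raddfD /= (Re_dotpC y x); ring.
Qed.

Lemma sqr_nrmB x y :
  nrm (x - y) ^+ 2 = nrm x ^+ 2 + nrm y ^+ 2 - 2 * complex.Re '<<x, y>>.
Proof. by rewrite sqr_nrmD nrmN dotpNr raddfN /= mulrN. Qed.

Lemma pythagoras x y : '<<x, y>> = 0 ->
  nrm (x + y) ^+ 2 = nrm x ^+ 2 + nrm y ^+ 2.
Proof. by move=> h; rewrite sqr_nrmD h /= mulr0 addr0. Qed.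

Lemma parallelogram x y :
  nrm (x - y) ^+ 2 = 2 * nrm x ^+ 2 + 2 * nrm y ^+ 2 - nrm (x + y) ^+ 2.
Proof. rewrite sqr_nrmB sqr_nrmD; ring. Qed.

(** The squared distance from [x] to the line spanned by [y]. Its nonnegativity is the
    Cauchy-Schwarz inequality, and the term subtracted measures how much a vector gets shorter when
    its component along [y] is removed. *)
Lemma gram_schmidt x y : y != 0 ->
  nrm (x - ('<<x, y>> / '<<y, y>>) *: y) ^+ 2 =
  nrm x ^+ 2 - complex.Re `|'<<x, y>>| ^+ 2 / nrm y ^+ 2.
Proof.
move=> y0; apply: complexI.
have n0 : '<<y, y>> != 0 by apply: contra_neq y0 => /dotpp_eq0.
have nrm0 : (nrm y ^+ 2)%:C%C != 0 :> R[i] by rewrite -dotpp.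
have cn : ('<<y, y>>)^* = '<<y, y>> by rewrite -dotp_conj.
have ct : ('<<x, y>> / '<<y, y>>)^* = '<<y, x>> / '<<y, y>>.
  by rewrite rmorphM fmorphV /= cn -dotp_conj.
have -> : (nrm x ^+ 2 - complex.Re `|'<<x, y>>| ^+ 2 / nrm y ^+ 2)%:C%C =
          '<<x, x>> - '<<x, y>> * '<<y, x>> / '<<y, y>>.
  rewrite !dotpp rmorphB; congr (_ - _).
  rewrite fmorph_div; congr (_ / _).
  by rewrite (dotp_conj y x) -normCK rmorphXn -[in RHS](RRe_real (normr_real _)).
rewrite -dotpp dotpBl !dotpBr dotpZl !dotpZr dotpZl ct.
by field.
Qed.

Lemma cauchy_schwarz x y : complex.Re `|'<<x, y>>| <= nrm x * nrm y.
Proof.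
have [->|y0] := eqVneq y 0; first by rewrite dotp0 normr0 nrm0 mulr0.
have ny0 : 0 < nrm y.
  by rewrite lt0r nrm_ge0 andbT; apply: contra_neq y0 => /nrm_eq0.
have := sqr_ge0 (nrm (x - ('<<x, y>> / '<<y, y>>) *: y)).
rewrite gram_schmidt// subr_ge0 ler_pdivrMr ?exprn_gt0// -exprMn.
by rewrite ler_sqr ?nnegrE ?mulr_ge0 ?nrm_ge0 ?Re_norm_ge0.
Qed.

Lemma nrm_sqr_le x y : nrm x ^+ 2 <= nrm y ^+ 2 -> nrm x <= nrm y.
Proof. by rewrite ler_sqr ?nnegrE ?nrm_ge0. Qed.

End InnerProduct.

(** One type for all the closed subspaces onto which vectors are projected: the members of an
    inductive system, the kernel of a functional, the closure of a sequence. *)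
Record csub (R : realType) (H : hilbertType R) := CSub {
  cs_set :> H -> Prop;
  cs0 : cs_set 0;
  csP : forall (k : R[i]) x y, cs_set x -> cs_set y -> cs_set (k *: x + y);
  cs_closed : closed cs_set
}.

Section Projection.
Context {R : realType} {H : hilbertType R} (S : csub H).
Implicit Types (x y z : H) (k : R[i]).

Lemma csZ k x : S x -> S (k *: x).
Proof. by move=> Sx; rewrite -[_ *: _]addr0; apply: csP => //; exact: cs0. Qed.

Lemma csD x y : S x -> S y -> S (x + y).
Proof. by move=> Sx Sy; rewrite -[x]scale1r; exact: csP. Qed.

Lemma csB x y : S x -> S y -> S (x - y).
Proof. by move=> Sx Sy; rewrite addrC -scaleN1r; exact: csP. Qed.

(** If [x - y] had a component along some [z] of [S], removing it would move [y] inside [S] and, by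
    [gram_schmidt], strictly decrease the distance. *)
Lemma minimizer_perp x y : S y ->
  (forall z, S z -> nrm (x - y) <= nrm (x - z)) -> perp (cs_set S) (x - y).
Proof.
move=> Sy h z Sz; have [->|z0] := eqVneq z 0; first by rewrite dotp0.
have nz0 : 0 < nrm z ^+ 2.
  rewrite exprn_gt0// lt0r nrm_ge0 andbT; apply: contra_neq z0; exact: nrm_eq0.
set t := '<<x - y, z>> / '<<z, z>>.
have : nrm (x - y) <= nrm (x - y - t *: z).
  by rewrite -addrA -opprD; apply: h; rewrite addrC; exact: csP.
rewrite -(@ler_pXn2r _ 2)// ?nnegrE ?nrm_ge0// gram_schmidt//.
rewrite -subr_ge0 addrAC subrr sub0r oppr_ge0 pmulr_lle0 ?invr_gt0//.
rewrite real_exprn_even_le0 ?num_real//= => /eqP h0.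
apply/eqP; rewrite -normr_eq0; apply/eqP.
by rewrite -[LHS]RRe_real ?normr_real// /= h0.
Qed.

(** A sequence in [S] whose distances to [x] tend to the infimum is Cauchy by the parallelogram law;
    its limit is a minimizer. *)
Lemma oproj_subproof x : exists y, S y /\ perp (cs_set S) (x - y).
Proof.
pose D := [set nrm (x - y) | y in cs_set S].
have D0 : D !=set0 by exists (nrm (x - 0)), 0 => //; exact: cs0.
have Dlb : lbound D 0 by move=> _ [y _ <-]; exact: nrm_ge0.
have hi : has_inf D by split => //; exists 0.
pose d := inf D.
have d0 : 0 <= d by exact: lb_le_inf.
have dle z : S z -> d <= nrm (x - z) by move=> Sz; apply: ge_inf; [exists 0|exists z].
have /choice[u hu] : forall n, exists y, S y /\ nrm (x - y) < d + n.+1%:R^-1.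
  move=> n; have := @inf_adherent _ D n.+1%:R^-1.
  by rewrite invr_gt0 ltr0n => /(_ isT hi)[_ [y Sy <-] hy]; exists y.
have ev (e : R) : 0 < e -> exists N, forall n, (N <= n)%N -> nrm (x - u n) < d + e.
  move=> e0; have := near_infty_natSinv_lt (PosNum e0) => -[N _ hN].
  exists N => n /hN /= hn; have [_ h] := hu n.
  by apply: lt_trans h _; rewrite ltrD2l.
(* The midpoint of [u m] and [u n] lies in [S], so its distance to [x] is at least [d]; this bounds
   from below the term that the parallelogram law subtracts. *)
have close m n e : nrm (x - u m) < d + e -> nrm (x - u n) < d + e ->
    nrm (u m - u n) ^+ 2 <= 4 * e * (2 * d + e).
  move=> hm hn.
  have -> : u m - u n = (x - u n) - (x - u m) by rewrite opprB [RHS]addrC addrA subrK.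
  have hs : 2 * d <= nrm ((x - u n) + (x - u m)).
    have -> : (x - u n) + (x - u m) = 2 *: (x - 2^-1 *: (u n + u m)).
      rewrite scalerBr scalerA divff ?pnatr_eq0// scale1r scaler_nat mulr2n.
      by rewrite addrACA opprD.
    rewrite nrmZ normr_nat -(rmorph_nat (@real_complex R)) /= ler_pM2l// ?ltr0n//.
    apply: dle; apply: csZ; apply: csD; exact: (hu _).1.
  rewrite parallelogram.
  have := nrm_ge0 (x - u n); have := nrm_ge0 (x - u m).
  move: hs hm hn; move: (nrm (_ + _)) (nrm _) (nrm _) => s a b; nra.
have [e e0|l hl] := nrm_cauchy_cvg (u := u).
  (* As [e' <= 1], the bound [4 * e' * (2 * d + e')] is below [4 * e' * (2 * d + 2)], which is at
     most [e ^+ 2]. *)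
  pose e' := Num.min 1 (e ^+ 2 / (4 * (2 * d + 2))).
  have den : 0 < 4 * (2 * d + 2) by lra.
  have e'0 : 0 < e' by rewrite lt_min ltr01 divr_gt0// exprn_gt0.
  have [N hN] := ev _ e'0; exists N => m n /hN hm /hN hn.
  rewrite -(@ltr_pXn2r _ 2)// ?nnegrE ?nrm_ge0 ?(ltW e0)//.
  apply: (le_lt_trans (close _ _ _ hm hn)).
  have e'1 : e' <= 1 by rewrite ge_min lexx.
  have : e' <= e ^+ 2 / (4 * (2 * d + 2)) by rewrite ge_min lexx orbT.
  rewrite ler_pdivlMr// => h2; nra.
have Sl : S l.
  apply/(closed_adherent (cs_set S)).1; first exact: cs_closed.
  by move=> e /hl[N /(_ _ (leqnn N))]; exists (u N) => //; exact: (hu _).1.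
exists l; split => //; apply: minimizer_perp => // z /dle; apply: le_trans.
apply/ler_addgt0Pr => e e0; have e2 : 0 < e / 2 by rewrite divr_gt0.
have [N hN] := ev _ e2; have [M hM] := hl _ e2.
have h1 := hN _ (leq_maxl N M); have h2 := hM _ (leq_maxr N M).
rewrite (le_trans (nrm_dist_trans (u (maxn N M)) _ _))// [e]splitr addrA.
by apply: lerD; [exact: ltW|rewrite nrm_dist; exact: ltW].
Qed.

Definition oproj x : H := projT1 (cid (oproj_subproof x)).

Lemma oproj_in x : S (oproj x).
Proof. by rewrite /oproj; case: cid => y []. Qed.

Lemma oproj_perp x : perp (cs_set S) (x - oproj x).
Proof. by rewrite /oproj; case: cid => y []. Qed.

Lemma oproj_unique x y : S y -> perp (cs_set S) (x - y) -> oproj x = y.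
Proof.
move=> Sy py; apply/eqP; rewrite -subr_eq0; apply/eqP/dotpp_eq0.
have h : S (oproj x - y) by apply: csB => //; exact: oproj_in.
rewrite -{1}(subrK x (oproj x)) -addrA dotpDl (py _ h) addr0.
by rewrite -opprB dotpNl (oproj_perp x h) oppr0.
Qed.

Lemma oproj_id x : S x -> oproj x = x.
Proof. by move=> Sx; apply: oproj_unique => // y _; rewrite subrr dot0p. Qed.

Lemma oproj_eq0 x : perp (cs_set S) x -> oproj x = 0.
Proof. by move=> px; apply: oproj_unique; [exact: cs0|rewrite subr0]. Qed.

Lemma oproj_eq0P x : oproj x = 0 -> perp (cs_set S) x.
Proof. by move=> p0; have := @oproj_perp x; rewrite p0 subr0. Qed.

Lemma oproj_sym x y : '<<oproj x, y>> = '<<x, oproj y>>.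
Proof.
have -> : '<<oproj x, y>> = '<<oproj x, oproj y>>.
  by apply/eqP; rewrite -subr_eq0 -dotpBr; apply/eqP/dotpC_eq0/oproj_perp/oproj_in.
apply/eqP; rewrite -subr_eq0 -dotpBl -opprB dotpNl oppr_eq0; apply/eqP/oproj_perp.
exact: oproj_in.
Qed.

Lemma oproj_nrm x : nrm (oproj x) <= nrm x.
Proof.
apply: nrm_sqr_le; rewrite -{2}(subrK (oproj x) x) pythagoras ?lerDr ?sqr_ge0//.
exact/oproj_perp/oproj_in.
Qed.

(** Additivity follows from symmetry, without returning to minimizers. *)
Lemma oprojB x y : oproj (x - y) = oproj x - oproj y.
Proof. by apply: dotp_ext => z; rewrite oproj_sym !dotpBl !oproj_sym. Qed.

End Projection.

(** * Closed subspaces as Hilbert spaces *)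

Section SubHilbert.
Variables (R : realType) (H : hilbertType R) (S : csub H).

Definition cs_pred : pred H := fun x => `[< S x >].

Lemma cs_pred_submod : submod_closed cs_pred.
Proof.
split=> [|k x y /asboolP Sx /asboolP Sy]; apply/asboolP; first exact: cs0.
exact: csP.
Qed.

HB.instance Definition _ := GRing.isSubmodClosed.Build R[i] H cs_pred
  cs_pred_submod.

Record subH := SubH {
  sval_of :> H;
  subHP : sval_of \in cs_pred
}.

HB.instance Definition _ := [isSub for sval_of].
HB.instance Definition _ := [Choice of subH by <:].
HB.instance Definition _ := [SubChoice_isSubLmodule of subH by <:].

Implicit Types (x y : subH).

Definition sub_norm x : R[i] := `|sval_of x|.

Lemma sub_normD x y : sub_norm (x + y) <= sub_norm x + sub_norm y.
Proof. exact: ler_normD. Qed.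

Lemma sub_normZ (k : R[i]) x : sub_norm (k *: x) = `|k| * sub_norm x.
Proof. exact: normrZ. Qed.

Lemma sub_norm0_eq0 x : sub_norm x = 0 -> x = 0.
Proof. by move=> /normr0_eq0 h; apply: val_inj. Qed.

HB.instance Definition _ := Lmodule_isNormed.Build R[i] subH
  sub_normD sub_normZ sub_norm0_eq0.

Lemma subH_normE x : `|x| = `|sval_of x|.
Proof. by []. Qed.

Lemma nrm_val x : nrm (sval_of x) = nrm x.
Proof. by []. Qed.

Lemma subH_in x : S (sval_of x).
Proof. exact: (asboolP _ (subHP x)). Qed.

(* [0] outside [S]; likewise for [inL] and [toE] below. *)
Definition inS (h : H) : subH := odflt 0 (insub h).

Lemma inSK h : S h -> sval_of (inS h) = h.
Proof. by move=> /asboolP Sh; rewrite /inS insubT. Qed.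

Lemma sval_ofK x : inS (sval_of x) = x.
Proof. by apply: val_inj; rewrite /= inSK//; exact: subH_in. Qed.

(** The image filter converges in [H], and its limit is adherent to the closed set [S]. *)
Lemma subH_complete (F : set_system subH) : ProperFilter F -> cauchy F -> cvg F.
Proof.
move=> FF cF.
have cG : cauchy (sval_of @ F).
  apply/cauchy_ballP => e e0; have [[A B] [FA FB] hAB] := (cauchy_ballP _).2 cF e e0.
  exists (sval_of @` A, sval_of @` B) => /=.
    by split; [apply: filterS FA|apply: filterS FB] => x hx; exists x.
  move=> [_ _] /= [[x Ax <-] [y By <-]].
  have := hAB (x, y) (conj Ax By).
  by rewrite /= -!ball_normE.
pose l := lim (sval_of @ F); have hl : sval_of @ F --> l := cauchy_cvg _ cG.
have near_l e : 0 < e -> F [set x | nrm (l - sval_of x) < e].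
  move=> e0; have /hl : nbhs l [set y | nrm (l - y) < e] by apply/nbhs_nrm; exists e.
  exact.
have Sl : S l.
  apply: ((closed_adherent (cs_set S)).1 (@cs_closed _ _ S)).
  move=> e /near_l/filter_ex[x hx]; exists (sval_of x) => //; exact: subH_in.
apply/cvg_ex; exists (inS l) => A /nbhs_nrm[e /near_l Fe hA].
by apply: filterS Fe => x hx; apply: hA; rewrite -nrm_val /= inSK.
Qed.

HB.instance Definition _ := Uniform_isComplete.Build subH subH_complete.

Definition sub_dotp x y : R[i] := '<<sval_of x, sval_of y>>.

Lemma sub_dotp_linear z x y (k : R[i]) :
  sub_dotp (k *: x + y) z = k * sub_dotp x z + sub_dotp y z.
Proof. exact: dotp_linear. Qed.

Lemma sub_dotp_conj x y : sub_dotp x y = (sub_dotp y x)^*.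
Proof. exact: dotp_conj. Qed.

Lemma sub_dotp_norm x : sub_dotp x x = `|x| ^+ 2.
Proof. exact: dotp_norm. Qed.

HB.instance Definition _ := isHilbert.Build R subH sub_dotp_linear sub_dotp_conj
  sub_dotp_norm.

Lemma subH_dotpE x y : '<<x, y>> = '<<sval_of x, sval_of y>>.
Proof. by []. Qed.

End SubHilbert.

(** * Adjoints and commutants *)

Section BoundedOperators.
Context {R : realType} {H : hilbertType R}.
Implicit Types (x y z : H) (k : R[i]) (T S : H -> H).

(** The bound on [f] makes its kernel closed. If [f x0] is nonzero, the component [z] of [x0]
    orthogonal to the kernel represents [f] up to a scalar. *)
Lemma riesz (f : H -> R[i]) (c : R) :
  (forall k x y, f (k *: x + y) = k * f x + f y) ->
  (forall x, complex.Re `|f x| <= c * nrm x) ->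
  exists y, forall x, f x = '<<x, y>>.
Proof.
move=> fl fc.
have f0 : f 0 = 0.
  have := fl 1 0 0; rewrite scale1r addr0 mul1r => /eqP.
  by rewrite -subr_eq0 opprD addrA subrr sub0r oppr_eq0 => /eqP.
have kerP k x y : f x = 0 -> f y = 0 -> f (k *: x + y) = 0.
  by move=> fx fy; rewrite fl fx fy mulr0 addr0.
have kerC : closed [set x | f x = 0].
  apply/closed_adherent => x h; apply/eqP; rewrite -normr_eq0; apply/eqP.
  rewrite -[LHS]RRe_real ?normr_real//; congr (_%:C%C); apply/eqP.
  rewrite eq_le; apply/andP; split; last exact: Re_norm_ge0.
  apply/ler_addgt0Pl => e e0; rewrite addr0.
  have d0 : 0 < e / (`|c| + 1) by rewrite divr_gt0// ltr_wpDl.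
  have [y /= fy xy] := h _ d0.
  have -> : f x = f (x - y) by rewrite addrC -scaleN1r fl fy mulr0 add0r.
  apply: le_trans (fc _) _; apply: (@le_trans _ _ ((`|c| + 1) * nrm (x - y))).
    by rewrite ler_wpM2r ?nrm_ge0// (le_trans (ler_norm c))// lerDl.
  by rewrite mulrC -ler_pdivlMr ?ltW// ltr_wpDl.
pose K := CSub f0 kerP kerC.
have [h|/existsNP[x0 fx0]] := pselect (forall x, f x = 0).
  by exists 0 => x; rewrite h dotp0.
pose z := x0 - oproj K x0.
have fz : f z = f x0.
  by rewrite /z addrC -scaleN1r fl (_ : f _ = 0) ?mulr0 ?add0r//; exact: (oproj_in K).
have z0 : '<<z, z>> != 0.
  apply/eqP => /dotpp_eq0 h; apply: fx0; by rewrite -fz h.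
exists (((f z)^* / '<<z, z>>) *: z) => x.
(* The vector [f z *: x - f x *: z] is in the kernel of [f], to which [z] is orthogonal. *)
have : '<<f z *: x - f x *: z, z>> = 0.
  apply/dotpC_eq0; have := @oproj_perp _ _ K x0; apply => /=.
  by rewrite addrC -scaleNr fl mulNr -[f z *: x]addr0 fl f0 addr0 mulrC addNr.
rewrite dotpBl !dotpZl dotpZr => /eqP; rewrite subr_eq0 => /eqP e.
have cn : ('<<z, z>>)^* = '<<z, z>> by rewrite -dotp_conj.
by rewrite rmorphM fmorphV /= conjCK cn mulrAC e mulfK.
Qed.

Lemma bounded_opP T : bounded_op T <->
  linear T /\ exists c : R, 0 <= c /\ forall x, nrm (T x) <= c * nrm x.
Proof.
split=> -[Tl [c hc]]; split=> //.
  have [c' [c'0 h]] := real_bound H H c; exists c'; split=> // x; exact: h.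
exists c%:C%C => x; rewrite !nrmE -rmorphM lecR; exact: hc.2.
Qed.

Lemma op_linearB T : linear T -> forall x y, T (x - y) = T x - T y.
Proof. by move=> Tl x y; rewrite addrC -scaleN1r Tl scaleN1r addrC. Qed.

(** The square of [nrm (S y)] is [<T (S y), y>]; apply Cauchy-Schwarz and divide by [nrm (S y)]. *)
Lemma adjoint_bounded T c : 0 <= c -> (forall x, nrm (T x) <= c * nrm x) ->
  forall S, is_adjoint T S -> forall y, nrm (S y) <= c * nrm y.
Proof.
move=> c0 hc S TS y; have [->|n0] := eqVneq (nrm (S y)) 0.
  by rewrite mulr_ge0 ?nrm_ge0.
have n_gt0 : 0 < nrm (S y) by rewrite lt0r n0 nrm_ge0.
have : nrm (S y) * nrm (S y) <= c * nrm (S y) * nrm y.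
  have -> : nrm (S y) * nrm (S y) = complex.Re `|'<<T (S y), y>>|.
    rewrite TS dotpp ger0_norm /= -?expr2//.
    by rewrite (@lecR _ 0) sqr_ge0.
  apply: le_trans (cauchy_schwarz _ _) _.
  by rewrite ler_wpM2r ?nrm_ge0.
by rewrite mulrAC ler_pM2r.
Qed.

Lemma adjoint_exists T : bounded_op T -> exists2 S, bounded_op S & is_adjoint T S.
Proof.
move=> /bounded_opP[Tl [c [c0 hc]]].
have /choice[S hS] : forall y, exists z, forall x, '<<T x, y>> = '<<x, z>>.
  move=> y; apply: (@riesz _ (c * nrm y)).
    by move=> k u v; rewrite Tl dotpZDl.
  move=> x; apply: le_trans (cauchy_schwarz _ _) _.
  by rewrite mulrAC ler_wpM2r ?nrm_ge0.
have TS : is_adjoint T S by move=> x y; exact: hS.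
exists S => //; apply/bounded_opP; split; last first.
  by exists c; split=> //; exact: adjoint_bounded TS.
move=> k u v; apply: dotp_ext => z.
by rewrite dotp_conj -hS dotpDr dotpZr !hS rmorphD rmorphM /= conjCK -!dotp_conj -dotpZDl.
Qed.

Definition commutant (P : set (H -> H)) : set (H -> H) :=
  [set T | bounded_op T /\ forall p, P p -> forall x, T (p x) = p (T x)].

(** Symmetric generators are linear and make the commutant stable under adjoints. The relation
    [T p = p T] survives weak operator limits, since it equates the matrix coefficients
    [<T (p x), z>] and [<T x, p z>]. *)
Lemma commutant_vN (P : set (H -> H)) :
  (forall p, P p -> forall x y, '<<p x, y>> = '<<x, p y>>) ->
  von_neumann_algebra (commutant P).
Proof.
move=> Psa.
have Plin p : P p -> linear p.
  by move=> Pp k x y; apply: dotp_ext => z; rewrite Psa// !dotpZDl !Psa.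
split.
- by move=> T [].
- split=> //; apply/bounded_opP; split=> //.
  by exists 1; split => // x; rewrite mul1r.
- move=> k T S [/bounded_opP[Tl [c [c0 hc]]] TP] [/bounded_opP[Sl [e [e0 he]]] SP].
  split; last by move=> p Pp x; rewrite !fctE TP// SP// (Plin p).
  apply/bounded_opP; split.
    move=> j u v; rewrite !fctE Tl Sl !scalerDr !scalerA mulrC -!addrA; congr (_ + _).
    by rewrite addrCA.
  exists (complex.Re `|k| * c + e).
  have k0 : 0 <= complex.Re `|k| by exact: Re_norm_ge0.
  split; first by rewrite addr_ge0 ?mulr_ge0.
  move=> x; rewrite !fctE; apply: le_trans (nrmD _ _) _.
  by rewrite mulrDl lerD// nrmZ -mulrA ler_wpM2l.
- move=> T S [/bounded_opP[Tl [c [c0 hc]]] TP] [/bounded_opP[Sl [e [e0 he]]] SP].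
  split; last by move=> p Pp x; rewrite /= SP// TP.
  apply/bounded_opP; split; first by move=> j u v; rewrite /= Sl Tl.
  exists (c * e); split; first exact: mulr_ge0.
  by move=> x /=; apply: le_trans (hc _) _; rewrite -mulrA ler_wpM2l.
- move=> T [bT TP]; have [S bS TS] := adjoint_exists bT.
  exists S => //; split => // p Pp x; apply: dotp_ext => z.
  by rewrite (Psa p Pp) !(dotp_conj _ z) !(dotp_conj _ (p z)) -!TS TP// (Psa p Pp).
- move=> F FF FM T bT TF; split => // p Pp x; apply: dotp_ext => z.
  rewrite (Psa p Pp).
  have hd := @norm_hausdorff _ (R[i]^o : normedModType R[i]).
  apply: (@cvg_unique _ hd ((fun S => '<<S (p x), z>>) @ F) _ _ _ (TF (p x) z)).
  apply: cvg_trans (TF x (p z)); apply: near_eq_cvg.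
  by apply: filterS FM => S [_ SP]; rewrite SP// (Psa p Pp).
Qed.

End BoundedOperators.

(** * Null sets, completions and integrals *)

Section AlmostEverywhere.
Context d (X : measurableType d) (R : realType) (mu : {measure set X -> \bar R}).

Lemma ae_forall_countable (I : Type) (P : I -> X -> Prop) : countable [set: I] ->
  (forall i, {ae mu, forall p, P i p}) -> {ae mu, forall p, forall i, P i p}.
Proof.
move=> /countable_injP[f finj] h.
have : {ae mu, forall p, forall n i, f i = n -> P i p}.
  apply: ae_foralln => n.
  have [[i <-]|no] := pselect (exists i, f i = n).
    by apply: filterS (h i) => p Pp j /finj ->//; rewrite inE.
  by apply: nearW => p i fi; case: no; exists i.
by apply: filterS => p Pp i; exact: (Pp (f i)).
Qed.

Lemma ae_counting (P : X -> Prop) : is_counting mu ->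
  {ae mu, forall p, P p} -> forall p, P p.
Proof.
move=> hc [B [mB B0 PB]] p.
apply: contrapT => nPp; have Bp : B p by exact: PB.
move: B0; rewrite hc// /counting; case: asboolP => [fB|//] [] /eqP.
rewrite pnatr_eq0 cardfs_eq0 => /eqP h0.
have : p \in fset_set B by rewrite in_fset_set// inE.
by rewrite h0 inE.
Qed.

End AlmostEverywhere.

(** By construction the completed sigma-algebra contains every subset of a Borel [nu]-null set. It
    remains to enclose a [mu]-null set of the completed sigma-algebra in a Borel [nu]-null set. *)
Lemma completion_complete (R : realType) (X : ptopologicalType)
    (nu : {measure set (borelType X) -> \bar R})
    (mu : {measure set (completedType nu) -> \bar R}) : is_completion mu ->
  forall N, mu.-negligible N -> measurable N.
Proof.
move=> hmu N [B [mB B0 NB]].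
have meas (A : set (borelType X)) : measurable A ->
    measurable (A : set (completedType nu)).
  move=> mA; apply: sub_sigma_algebra; exists A => //; exists set0.
    exact: negligible_set0.
  by rewrite setU0.
(* The completed sigma-algebra is generated by unions with null sets; all its
   members lie between two Borel sets that differ by a null set. *)
pose between (B : set X) := exists A1 A2 : set (borelType X),
  [/\ measurable A1, measurable A2, A1 `<=` B, B `<=` A2 & nu (A2 `\` A1) = 0%E].
suff [A1 [A2 [mA1 mA2 A1B BA2 nu0]]] : between B.
  apply: sub_sigma_algebra; exists set0 => //; exists N; last by rewrite set0U.
  exists A2; split => //; last exact: subset_trans BA2.
  have A10 : nu A1 = 0%E.
    rewrite -hmu//; apply/eqP; rewrite eq_le measure_ge0 andbT -B0.
    by apply: le_measure; rewrite ?inE//; exact: meas.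
  have le0 : (nu A1 + nu (A2 `\` A1) <= 0)%E by rewrite A10 nu0 adde0.
  apply/eqP; rewrite eq_le measure_ge0 andbT.
  rewrite -(setDUK (subset_trans A1B BA2)); apply: le_trans le0.
  by apply: measureU2 => //; exact: measurableD.
suff : <<s completed_algebra_gen nu >> `<=` between by apply; exact: mB.
apply: smallest_sub; last first.
  move=> _ [A mA [M [C [mC C0 MC]] <-]].
  exists A, (A `|` C); split => //.
  - exact: measurableU.
  - exact: setUS.
  - apply/eqP; rewrite eq_le measure_ge0 andbT -C0; apply: le_measure.
    + by rewrite inE; apply: measurableD => //; exact: measurableU.
    + by rewrite inE.
    + by move=> x [[//|//]].
split.
- by exists set0, set0; split => //; rewrite setD0 measure0.
- move=> A [A1 [A2 [mA1 mA2 A1A AA2 nu0]]]; exists (~` A2), (~` A1); split.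
  + exact: measurableC.
  + exact: measurableC.
  + by move=> x nA2; split => // /AA2.
  + by move=> x [_ nA] /A1A.
  + by rewrite setDE setCK setIC -setDE.
- move=> A hA.
  have /choice[A12 h] : forall i, exists A12 : set (borelType X) * set (borelType X),
      [/\ measurable A12.1, measurable A12.2, A12.1 `<=` A i, A i `<=` A12.2 &
       nu (A12.2 `\` A12.1) = 0%E].
    by move=> i; have [A1 [A2 ?]] := hA i; exists (A1, A2).
  exists (\bigcup_i (A12 i).1), (\bigcup_i (A12 i).2); split.
  + by apply: bigcupT_measurable => i; have [] := h i.
  + by apply: bigcupT_measurable => i; have [] := h i.
  + by apply: subset_bigcup => i _; have [] := h i.
  + by apply: subset_bigcup => i _; have [] := h i.
  + apply: measure_negligible.
      by apply: measurableD; apply: bigcupT_measurable => i; have [] := h i.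
    apply: (@negligibleS _ _ _ _ (\bigcup_i ((A12 i).2 `\` (A12 i).1))).
      move=> x [[i _ A2x] nA1]; exists i => //; split => // A1x.
      by apply: nA1; exists i.
    apply: negligible_bigcup => i; have [m1 m2 _ _ n0] := h i.
    by exists ((A12 i).2 `\` (A12 i).1); split => //; exact: measurableD.
Qed.

(** * Integrals of real and complex functions *)

Section RealIntegral.
Context (R : realType) d (X : measurableType d) (mu : {measure set X -> \bar R}).
Implicit Types (f g : X -> R) (B : set X).

Definition rintegrable f := mu.-integrable setT (EFin \o f).
Definition rint f : R := Rintegral mu setT f.

Lemma rintegrable_meas f : rintegrable f -> measurable_fun setT f.
Proof. by move=> /integrableP[/measurable_EFinP]. Qed.

Lemma rintegrableZD (c : R) f g : rintegrable f -> rintegrable g ->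
  rintegrable (fun p => c * f p + g p).
Proof.
move=> hf hg.
exact: eq_integrable (integrableD measurableT (integrableZl measurableT c hf) hg).
Qed.

Lemma rintZD (c : R) f g : rintegrable f -> rintegrable g ->
  rint (fun p => c * f p + g p) = c * rint f + rint g.
Proof.
move=> hf hg; rewrite /rint RintegralD//; first by rewrite RintegralZl.
exact: eq_integrable (integrableZl measurableT c hf).
Qed.

Lemma rintegrable0 : rintegrable (fun=> 0).
Proof. exact: integrable0. Qed.

Lemma rintegrable_if f B : measurable B -> rintegrable f ->
  rintegrable (fun p => if p \in B then f p else 0).
Proof.
move=> mB hf; have /(integrable_mkcond _ mB) := integrableS measurableT mB (@subsetT _ B) hf.
apply: eq_integrable => // p _; rewrite /restrict /patch /=.
by case: ifP.
Qed.

Lemma rintegrable_ae f g : measurable_fun setT g -> rintegrable f ->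
  {ae mu, forall p, f p = g p} -> rintegrable g.
Proof.
move=> mg /integrableP[mf fi] fg; apply/integrableP; split; first exact/measurable_EFinP.
rewrite (le_lt_trans _ fi)//.
rewrite (@ae_eq_integral _ _ _ mu setT (fun p => `|(EFin \o f) p|)%E)//.
- by apply: measurableT_comp => //; exact/measurable_EFinP.
- exact: measurableT_comp.
- by apply: filterS fg => p /= -> _.
Qed.

(** Measurability of [g] comes from completeness: preimages under [g] and [f] differ only inside a
    negligible set, all of whose subsets are measurable. *)
Lemma rintegrable_ae_complete f g : (forall N, mu.-negligible N -> measurable N) ->
  rintegrable f -> {ae mu, forall p, f p = g p} -> rintegrable g.
Proof.
move=> mu_complete fi fg; apply: rintegrable_ae (fi) (fg) => _ Y mY; rewrite setTI.
have neg : mu.-negligible [set p | f p <> g p] by apply: negligibleS fg.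
rewrite (_ : g @^-1` Y = (g @^-1` Y `&` [set p | f p <> g p]) `|`
  (f @^-1` Y `\` [set p | f p <> g p])).
  apply: measurableU; first by apply: mu_complete; apply: negligibleS neg => p [].
  apply: measurableD; last exact: mu_complete.
  by rewrite -[_ @^-1` _]setTI; exact: (rintegrable_meas fi).
apply/seteqP; split=> p /=.
  have [e|e] := pselect (f p = g p); last by left.
  by rewrite -e; right; split => //; apply.
by move=> [[]//|[Yf /contrapT <-]].
Qed.

Lemma rint_ae f g : rintegrable f -> rintegrable g ->
  {ae mu, forall p, f p = g p} -> rint f = rint g.
Proof.
move=> /integrableP[mf _] /integrableP[mg _] fg; congr fine.
by apply: ae_eq_integral => //; apply: filterS fg => p /= ->.
Qed.

Lemma rint_ge0 f : (forall p, 0 <= f p) -> 0 <= rint f.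
Proof. by move=> f0; apply: Rintegral_ge0. Qed.

Lemma rint_eq0 f : rintegrable f -> (forall p, 0 <= f p) -> rint f = 0 ->
  {ae mu, forall p, f p = 0}.
Proof.
move=> fi f0 If0; have [mf _] := integrableP _ _ _ fi.
have : (\int[mu]_(x in setT) `|(EFin \o f) x| = 0)%E.
  rewrite (eq_integral (EFin \o f)); last first.
    by move=> p _ /=; rewrite ger0_norm.
  have := integrable_fin_num measurableT fi.
  by move: If0; rewrite /rint /Rintegral => h /fineK <-; rewrite h.
move=> /(ae_eq_integral_abs mu measurableT mf); apply: filterS => p /(_ I).
by case.
Qed.

(** Test on [B = {f > 0}]: the truncated function is nonnegative with integral [0], hence null
    almost everywhere. *)
Lemma rint_le0 f : rintegrable f ->
  (forall B, measurable B -> rint (fun p => if p \in B then f p else 0) <= 0) ->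
  {ae mu, forall p, f p <= 0}.
Proof.
move=> fi h; pose B := [set p | 0 < f p].
have mB : measurable B.
  have := @measurable_fun_ltr _ _ _ setT (fun=> 0) f (measurable_cst (0 : R)) (rintegrable_meas fi).
  by move=> /(_ measurableT [set true]); rewrite setTI; apply.
have F0 p : 0 <= (if p \in B then f p else 0).
  by case: ifPn => // /set_mem /ltW.
have Fi := rintegrable_if mB fi.
have /(rint_eq0 Fi F0) : rint (fun p => if p \in B then f p else 0) = 0.
  by apply/eqP; rewrite eq_le h// rint_ge0.
apply: filterS => p; case: ifPn => [_ -> //|/negP nB _].
by rewrite leNgt; apply/negP => fp; apply: nB; rewrite inE.
Qed.

(** By Markov's inequality the sets [{f n >= e}] have arbitrarily small measure, so their
    intersection is null. No convergence of the sequence is involved, which suits distances to a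
    dense sequence. *)
Lemma markov_inf (f : nat -> X -> R) :
  (forall n, rintegrable (f n)) -> (forall n p, 0 <= f n p) ->
  (forall e : R, 0 < e -> exists n, rint (f n) < e) ->
  forall e : R, 0 < e -> {ae mu, forall p, exists n, f n p < e}.
Proof.
move=> fi f0 hf e e0.
pose A n := [set p | (e%:E <= `|(f n p)%:E|)%E].
have mA n : measurable (A n).
  rewrite -[A n]setTI; apply: emeasurable_fun_c_infty => //.
  by apply: measurableT_comp => //; case/integrableP: (fi n).
exists (\bigcap_n A n); split; first exact: bigcapT_measurable.
- apply/eqP; rewrite eq_le measure_ge0 andbT; apply/lee_addgt0Pr => r r0; rewrite add0e.
  have [n hn] := hf (r * e) (mulr_gt0 r0 e0).
  apply: (@le_trans _ _ (mu (A n))).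
    apply: le_measure; rewrite ?inE//; first exact: bigcapT_measurable.
    exact: bigcap_inf.
  have mfn : measurable_fun setT (EFin \o f n) by case/integrableP: (fi n).
  have := le_integral_abse mu measurableT mfn e0; rewrite setTI => /= h.
  have hI : (\int[mu]_x `|(f n x)%:E| = (rint (f n))%:E)%E.
    rewrite /rint /Rintegral fineK; last exact: integrable_fin_num (fi n).
    by apply: eq_integral => p _ /=; rewrite ger0_norm.
  rewrite -(@lee_pmul2l _ e%:E)//; apply: le_trans h _.
  by rewrite hI -EFinM lee_fin mulrC ltW.
- move=> p /= np n _; rewrite /A /= ger0_norm// lee_fin leNgt; apply/negP => h.
  by apply: np; exists n.
Qed.

Lemma C_integrable_ZD k (f g : X -> R[i]) : C_integrable mu f -> C_integrable mu g ->
  C_integrable mu (fun p => k * f p + g p).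
Proof.
move=> [fr fi] [gr gi]; split.
- apply: (@eq_integrable _ _ _ _ _ measurableT (EFin \o (fun p =>
    complex.Re k * complex.Re (f p) + (- complex.Im k * complex.Im (f p) + complex.Re (g p))))).
    by move=> p _ /=; case: k (f p) (g p) => [a b] [u v] [s t] /=; congr EFin; ring.
  by apply: rintegrableZD => //; exact: rintegrableZD.
- apply: (@eq_integrable _ _ _ _ _ measurableT (EFin \o (fun p =>
    complex.Re k * complex.Im (f p) + (complex.Im k * complex.Re (f p) + complex.Im (g p))))).
    by move=> p _ /=; case: k (f p) (g p) => [a b] [u v] [s t] /=; congr EFin; ring.
  by apply: rintegrableZD => //; exact: rintegrableZD.
Qed.

Lemma C_integral_ZD k (f g : X -> R[i]) : C_integrable mu f -> C_integrable mu g ->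
  C_integral mu (fun p => k * f p + g p) = k * C_integral mu f + C_integral mu g.
Proof.
move=> [fr fi] [gr gi]; rewrite /C_integral.
have -> : (fun p => complex.Re (k * f p + g p)) = (fun p =>
    complex.Re k * complex.Re (f p) + (- complex.Im k * complex.Im (f p) + complex.Re (g p))).
  by apply/funext => p; case: k (f p) (g p) => [a b] [u v] [s t] /=; ring.
have -> : (fun p => complex.Im (k * f p + g p)) = (fun p =>
    complex.Re k * complex.Im (f p) + (complex.Im k * complex.Re (f p) + complex.Im (g p))).
  by apply/funext => p; case: k (f p) (g p) => [a b] [u v] [s t] /=; ring.
rewrite -/(rint _) -/(rint _) !rintZD//; try exact: rintegrableZD.
rewrite /rint; case: k => a b /=; congr Complex; ring.
Qed.

Lemma C_integral_ae (f g : X -> R[i]) : C_integrable mu f -> C_integrable mu g ->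
  {ae mu, forall p, f p = g p} -> C_integral mu f = C_integral mu g.
Proof.
move=> [fr fi] [gr gi] fg; congr Complex; apply: rint_ae => //;
  by apply: filterS fg => p ->.
Qed.

End RealIntegral.

(** * Direct integrals *)

Section DirectIntegralTheory.
Context (R : realType) d (X : measurableType d) (mu : {measure set X -> \bar R}).
Hypothesis mu_complete : forall N, mu.-negligible N -> measurable N.
Context (H : X -> hilbertType R) (V : forall p, csub (H p)).
Context (G : hilbertType R) (ev : G -> forall p, H p).
Hypothesis hdi : direct_integral mu (fun p => cs_set (V p)) (setT : set G) ev.
Implicit Types (x y u : G) (B : set X) (T : G -> G) (xs : nat -> G).

Lemma di_in x p : V p (ev x p).
Proof. exact: (di_fiber hdi). Qed.

Lemma di_Cint x y : C_integrable mu (fun p => '<<ev x p, ev y p>>).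
Proof. exact: (di_integrable hdi). Qed.

Lemma di_dotpE x y : '<<x, y>> = C_integral mu (fun p => '<<ev x p, ev y p>>).
Proof. exact: (di_dotp hdi). Qed.

Lemma di_Re x y : rintegrable mu (fun p => complex.Re '<<ev x p, ev y p>>).
Proof. exact: (di_Cint x y).1. Qed.

Lemma di_Re_rint x y :
  rint mu (fun p => complex.Re '<<ev x p, ev y p>>) = complex.Re '<<x, y>>.
Proof. by rewrite di_dotpE. Qed.

Lemma sqr_nrmE (K : hilbertType R) (v : K) : nrm v ^+ 2 = complex.Re '<<v, v>>.
Proof. by rewrite dotpp. Qed.

Lemma di_sqr x : rintegrable mu (fun p => nrm (ev x p) ^+ 2).
Proof.
by apply: eq_integrable (di_Re x x) => // p _ /=; rewrite sqr_nrmE.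
Qed.

Lemma di_sqr_rint x : rint mu (fun p => nrm (ev x p) ^+ 2) = nrm x ^+ 2.
Proof.
rewrite (sqr_nrmE x) -di_Re_rint; congr rint; apply/funext => p; exact: sqr_nrmE.
Qed.

(** The coefficients [-2] and [1] give the expansion the shape [c * f + g] of [rintegrableZD] and
    [rintZD]. *)
Lemma di_dist_aux x y : (fun p => nrm (ev x p - ev y p) ^+ 2) =
  (fun p => -2 * complex.Re '<<ev x p, ev y p>> +
    (1 * nrm (ev x p) ^+ 2 + nrm (ev y p) ^+ 2)).
Proof. by apply/funext => p; rewrite sqr_nrmB; ring. Qed.

Lemma di_dist x y : rintegrable mu (fun p => nrm (ev x p - ev y p) ^+ 2).
Proof.
rewrite di_dist_aux; apply: rintegrableZD; first exact: di_Re.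
by apply: rintegrableZD; exact: di_sqr.
Qed.

Lemma di_dist_rint x y :
  rint mu (fun p => nrm (ev x p - ev y p) ^+ 2) = nrm (x - y) ^+ 2.
Proof.
rewrite di_dist_aux rintZD; [|exact: di_Re|by apply: rintegrableZD; exact: di_sqr].
rewrite rintZD; [|exact: di_sqr|exact: di_sqr].
by rewrite di_Re_rint !di_sqr_rint sqr_nrmB; ring.
Qed.

(* Linearity of evaluation is not part of [direct_integral]: with
   [w = (k x + y) - k x - y] taken fibrewise, [<w(p), u(p)>] integrates to [0] for
   every [u] of the space, hence so does [<w(p), w(p)>]. *)
Lemma di_linear (k : R[i]) x y :
  {ae mu, forall p, ev (k *: x + y) p = k *: ev x p + ev y p}.
Proof.
pose z := k *: x + y; pose w p := ev z p - k *: ev x p - ev y p.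
have wE u : (fun p => '<<w p, ev u p>>) = (fun p => (- k) * '<<ev x p, ev u p>> +
    ((-1) * '<<ev y p, ev u p>> + '<<ev z p, ev u p>>)).
  by apply/funext => p; rewrite /w !dotpBl dotpZl; ring.
have wi u : C_integrable mu (fun p => '<<w p, ev u p>>).
  by rewrite wE; apply: C_integrable_ZD; [|apply: C_integrable_ZD]; exact: di_Cint.
have w0 u : C_integral mu (fun p => '<<w p, ev u p>>) = 0.
  rewrite wE C_integral_ZD; [|exact: di_Cint|by apply: C_integrable_ZD; exact: di_Cint].
  rewrite C_integral_ZD; [|exact: di_Cint|exact: di_Cint].
  by rewrite -!di_dotpE dotpZDl; ring.
have wwE : (fun p => '<<w p, w p>>) = (fun p => (- k^*) * '<<w p, ev x p>> +
    ((-1) * '<<w p, ev y p>> + '<<w p, ev z p>>)).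
  by apply/funext => p; rewrite {2}/w !dotpBr dotpZr; ring.
have wwi : C_integrable mu (fun p => '<<w p, w p>>).
  by rewrite wwE; apply: C_integrable_ZD; [|apply: C_integrable_ZD]; exact: wi.
have ww0 : C_integral mu (fun p => '<<w p, w p>>) = 0.
  rewrite wwE C_integral_ZD; [|exact: wi|by apply: C_integrable_ZD; exact: wi].
  rewrite C_integral_ZD; [|exact: wi|exact: wi].
  by rewrite !w0; ring.
have := @rint_eq0 _ _ _ mu (fun p => complex.Re '<<w p, w p>>) wwi.1.
have -> : rint mu (fun p => complex.Re '<<w p, w p>>) = 0 by case: ww0.
have h p : 0 <= complex.Re '<<w p, w p>> by rewrite -sqr_nrmE sqr_ge0.
move=> /(_ h erefl); apply: filterS => p; rewrite -sqr_nrmE => /eqP.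
rewrite sqrf_eq0 => /eqP/nrm_eq0 /eqP; rewrite /w -addrA -opprD subr_eq0.
by move=> /eqP.
Qed.

Lemma dicut_exists B x : measurable B ->
  exists y, {ae mu, forall p, ev y p = if p \in B then ev x p else 0}.
Proof.
move=> mB; pose f p := if p \in B then ev x p else 0.
have fV p : V p (f p) by rewrite /f; case: ifP => _; [exact: di_in|exact: cs0].
have [y|y _ hy] := di_complete hdi fV; last by exists y.
move=> _; have [hr hi] := di_Cint x y; split.
- apply: eq_integrable (rintegrable_if mB hr) => // p _ /=.
  by rewrite /f; case: ifP => // _; rewrite dot0p.
- apply: eq_integrable (rintegrable_if mB hi) => // p _ /=.
  by rewrite /f; case: ifP => // _; rewrite dot0p.
Qed.

(* Multiplication by the indicator of [B], and [0] when [B] is not measurable. *)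
Definition dicut B x : G :=
  if pselect (measurable B) is left mB then projT1 (cid (dicut_exists x mB)) else 0.

Lemma dicutE B x : measurable B ->
  {ae mu, forall p, ev (dicut B x) p = if p \in B then ev x p else 0}.
Proof. by move=> mB; rewrite /dicut; case: pselect => // mB'; case: cid. Qed.

Lemma dicut_sym B x y : measurable B -> '<<dicut B x, y>> = '<<x, dicut B y>>.
Proof.
move=> mB; rewrite !di_dotpE; apply: C_integral_ae; [exact: di_Cint|exact: di_Cint|].
near=> p.
have -> : ev (dicut B x) p = if p \in B then ev x p else 0.
  by near: p; exact: dicutE.
have -> : ev (dicut B y) p = if p \in B then ev y p else 0.
  by near: p; exact: dicutE.
by case: ifP => // _; rewrite dot0p dotp0.
Unshelve. all: by end_near. Qed.

Lemma di_ext x y : {ae mu, forall p, ev x p = ev y p} -> x = y.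
Proof.
move=> xy; apply: dotp_ext => z; rewrite !di_dotpE.
apply: C_integral_ae; [exact: di_Cint|exact: di_Cint|].
by apply: filterS xy => p ->.
Qed.

Lemma dicut_nrm B x : measurable B ->
  nrm (dicut B x) ^+ 2 = rint mu (fun p => if p \in B then nrm (ev x p) ^+ 2 else 0).
Proof.
move=> mB; rewrite -di_sqr_rint; apply: rint_ae; first exact: di_sqr.
  by apply: rintegrable_if => //; exact: di_sqr.
apply: filterS (dicutE x mB) => p ->; case: ifP => // _.
by rewrite nrm0 expr0n.
Qed.

Definition commutes_cuts T := forall B, measurable B -> forall x, T (dicut B x) = dicut B (T x).

(** For every measurable [B], the integral of [|(T x)(p)|^2] over [B] is the squared norm of [T]
    applied to the cut of [x], hence at most [c ^+ 2] times the integral of [|x(p)|^2] over [B]. As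
    [B] is arbitrary, [rint_le0] makes the bound pointwise. *)
Lemma fiber_bound T (c : R) : 0 <= c -> (forall x, nrm (T x) <= c * nrm x) ->
  commutes_cuts T ->
  forall x, {ae mu, forall p, nrm (ev (T x) p) <= c * nrm (ev x p)}.
Proof.
move=> c0 hc TB x.
have gi : rintegrable mu (fun p => (- c ^+ 2) * nrm (ev x p) ^+ 2 + nrm (ev (T x) p) ^+ 2).
  by apply: rintegrableZD; exact: di_sqr.
have : {ae mu, forall p, (- c ^+ 2) * nrm (ev x p) ^+ 2 + nrm (ev (T x) p) ^+ 2 <= 0}.
  apply: rint_le0 => // B mB.
  have -> : (fun p => if p \in B then - c ^+ 2 * nrm (ev x p) ^+ 2 + nrm (ev (T x) p) ^+ 2
      else 0) = (fun p => (- c ^+ 2) * (if p \in B then nrm (ev x p) ^+ 2 else 0) +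
      (if p \in B then nrm (ev (T x) p) ^+ 2 else 0)).
    by apply/funext => p; case: ifP => // _; rewrite mulr0 addr0.
  rewrite rintZD; [|by apply: rintegrable_if => //; exact: di_sqr..].
  rewrite -!dicut_nrm// -TB// mulNr addrC subr_le0 -exprMn.
  by rewrite ler_sqr ?nnegrE ?mulr_ge0 ?nrm_ge0.
apply: filterS => p; rewrite mulNr addrC subr_le0 -exprMn.
by rewrite ler_sqr ?nnegrE ?mulr_ge0 ?nrm_ge0.
Qed.

Definition dense_seq (K : normedModType R[i]) (ys : nat -> K) :=
  forall (u : K) (e : R), 0 < e -> exists n, nrm (u - ys n) < e.

(** The functions [|u(p) - x_n(p)|^2] have integrals [nrm (u - x_n) ^+ 2], arbitrarily small by
    density; [markov_inf] applies at each of countably many thresholds. *)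
Lemma fiber_adherent xs : dense_seq xs -> forall u,
  {ae mu, forall p, adherent (range (fun n => ev (xs n) p)) (ev u p)}.
Proof.
move=> xsd u.
have : {ae mu, forall p, forall k, exists n, nrm (ev u p - ev (xs n) p) ^+ 2 < k.+1%:R^-1 ^+ 2}.
  apply: ae_foralln => k; apply: markov_inf => //.
  - by move=> n; exact: di_dist.
  - by move=> n p; exact: sqr_ge0.
  (* The integral is a squared norm; a number below both [e] and [1] has its square below [e]. *)
  - move=> e e0; have [n hn] := xsd u (Num.min e 1) ltac:(by rewrite lt_min e0 ltr01).
    exists n; rewrite di_dist_rint.
    move: hn; rewrite lt_min => /andP[h1 h2].
    by have := nrm_ge0 (u - xs n); nra.
apply: filterS => p hp e e0.
have := near_infty_natSinv_lt (PosNum e0) => -[N _ /(_ N (leqnn N)) /= hN].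
have [n hn] := hp N; exists (ev (xs n) p); first by exists n.
apply: lt_trans hN; move: hn; rewrite ltr_sqr ?nnegrE ?nrm_ge0//.
Qed.

(* Where the [x_n(p)] are not total, choose [f(p) <> 0] orthogonal to all of them,
   without any measurability. Completeness of [mu] makes [<f(p), y(p)>], which
   is null almost everywhere, measurable, so [f] is a vector of the direct
   integral, orthogonal to itself. *)
Lemma fiber_total xs : dense_seq xs -> {ae mu, forall p, forall v, V p v ->
  (forall n, '<<v, ev (xs n) p>> = 0) -> v = 0}.
Proof.
move=> xsd.
pose P p v := [/\ V p v, (forall n, '<<v, ev (xs n) p>> = 0) & v <> 0].
pose f p := if pselect (exists v, P p v) is left h then projT1 (cid h) else 0.
have fV p : V p (f p).
  by rewrite /f; case: pselect => [h|_]; [case: cid => v []|exact: cs0].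
have fperp p n : '<<f p, ev (xs n) p>> = 0.
  rewrite /f; case: pselect => [h|_]; last exact: dot0p.
  by case: cid => v [_ + _] /=; exact.
have fperp_all u : {ae mu, forall p, '<<f p, ev u p>> = 0}.
  apply: filterS (fiber_adherent xsd u) => p hp.
  apply/eqP; rewrite -normr_eq0; apply/eqP.
  rewrite -[LHS]RRe_real ?normr_real//; congr (_%:C%C); apply/eqP.
  rewrite eq_le; apply/andP; split; last exact: Re_norm_ge0.
  apply/ler_addgt0Pl => e e0; rewrite addr0.
  have n0 := nrm_ge0 (f p).
  have d0 : 0 < e / (nrm (f p) + 1) by rewrite divr_gt0// ltr_wpDl.
  have [_ [n _ <-] hn] := hp _ d0.
  have -> : '<<f p, ev u p>> = '<<f p, ev u p - ev (xs n) p>>.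
    by rewrite dotpBr fperp subr0.
  apply: le_trans (cauchy_schwarz _ _) _.
  apply: (@le_trans _ _ ((nrm (f p) + 1) * nrm (ev u p - ev (xs n) p))).
    by rewrite ler_wpM2r ?nrm_ge0// lerDl.
  by rewrite mulrC -ler_pdivlMr ?ltW// ltr_wpDl.
have ae0 (g : X -> R) : {ae mu, forall p, g p = 0} -> rintegrable mu g.
  move=> g0; apply: (rintegrable_ae_complete mu_complete (rintegrable0 mu)).
  by apply: filterS g0 => p ->.
have [u|u _ hu] := di_complete hdi fV.
  by move=> _; split; apply: ae0; apply: filterS (fperp_all u) => p ->.
near=> p => v Vv v0.
have fE : ev u p = f p by near: p.
have : '<<f p, ev u p>> = 0 by near: p; exact: fperp_all.
rewrite fE => /dotpp_eq0; rewrite /f; case: pselect => [h|nh _].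
  by case: cid => w [_ _ w0] /=.
by apply: contrapT => vn0; apply: nh; exists v.
Unshelve. all: by end_near. Qed.

End DirectIntegralTheory.

(** * Fibres of an operator *)

Section LipschitzExtension.
Context {R : realType} {H : hilbertType R} (S : csub H).
Implicit Types (v w : H) (t : H -> H) (g h : nat -> H) (c e : R).

(** A countable dense set of scalars, so that linear relations with these coefficients can hold off
    a single null set. *)
Definition ratC (q : rat * rat) : R[i] := Complex (ratr q.1) (ratr q.2).

Lemma ratC_dense (k : R[i]) e : 0 < e -> exists q, complex.Re `|k - ratC q| < e.
Proof.
move=> e0; have e2 : 0 < e / 2 by rewrite divr_gt0.
have near_rat (r : R) : exists q : rat, `|r - ratr q| < e / 2.
  have [q hq] := @rat_in_itvoo R (r - e / 2) (r + e / 2) ltac:(lra).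
  by exists q; rewrite distrC ltr_distl; move: hq; rewrite in_itv.
case: k => a b; have [q1 h1] := near_rat a; have [q2 h2] := near_rat b.
exists (q1, q2); rewrite normc_def /=.
apply: (@le_lt_trans _ _ (`|a - ratr q1| + `|b - ratr q2|)); last first.
  by rewrite [e]splitr ltrD.
rewrite -[leRHS]ger0_norm ?addr_ge0// -sqrtr_sqr ler_wsqrtr//.
rewrite -[(a - _) ^+ 2]real_normK ?num_real// -[(b - _) ^+ 2]real_normK ?num_real//.
have := normr_ge0 (a - ratr q1); have := normr_ge0 (b - ratr q2); nra.
Qed.

Lemma comb_dist (k q : R[i]) (x y a b : H) : nrm ((k *: x + y) - (q *: a + b)) <=
  complex.Re `|k - q| * nrm x + complex.Re `|q| * nrm (x - a) + nrm (y - b).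
Proof.
have -> : (k *: x + y) - (q *: a + b) = (k - q) *: x + q *: (x - a) + (y - b).
  by rewrite scalerBl scalerBr subrKA opprD addrACA.
by apply: le_trans (nrmD _ _) _; rewrite lerD2r -!nrmZ; exact: nrmD.
Qed.

(** Makes each of the three error terms of [comb_dist] at most [e]. The scalar [q] is chosen first,
    since the precision needed for [g m] depends on the modulus of [q]. *)
Lemma comb_approx g (k : R[i]) v w (A e : R) : 0 <= A -> 0 < e ->
  adherent (range g) v -> adherent (range g) w ->
  exists q m n, [/\ complex.Re `|k - ratC q| * A <= e,
    complex.Re `|ratC q| * nrm (v - g m) <= e & nrm (w - g n) <= e].
Proof.
move=> A0 e0 hv hw.
have A1 : 0 < A + 1 by rewrite ltr_wpDl.
have [q hq] := ratC_dense k (divr_gt0 e0 A1).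
have q0 := Re_norm_ge0 (ratC q : R[i]).
have kq0 := Re_norm_ge0 (k - ratC q).
have q1 : 0 < complex.Re `|ratC q| + 1 by rewrite ltr_wpDl.
have [_ [m _ <-] hm] := hv _ (divr_gt0 e0 q1).
have [_ [n _ <-] hn] := hw _ e0.
exists q, m, n; split; last exact: ltW.
- move: hq; rewrite ltr_pdivlMr// => /ltW; apply: le_trans.
  by rewrite ler_wpM2l// lerDl.
- move: hm; rewrite ltr_pdivlMr// mulrC => /ltW; apply: le_trans.
  by rewrite ler_wpM2r ?nrm_ge0// lerDl.
Qed.

Definition lip_on c t := forall v w, S v -> S w -> nrm (t v - t w) <= c * nrm (v - w).

Lemma lip_eq c c' t t' g v : 0 <= c -> 0 <= c' -> lip_on c t -> lip_on c' t' ->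
  (forall n, S (g n)) -> (forall n, t (g n) = t' (g n)) ->
  S v -> adherent (range g) v -> t v = t' v.
Proof.
move=> c0 c'0 ht ht' Sg tg Sv hv; apply: eq_of_nrm => e e0.
have d0 : 0 < c + c' + 1 by rewrite ltr_wpDl ?addr_ge0.
have [_ [n _ <-] hn] := hv _ (divr_gt0 e0 d0).
apply: le_trans (nrm_dist_trans (t (g n)) _ _) _; rewrite {2}tg.
have h1 := ht _ _ Sv (Sg n); have h2 := ht' _ _ (Sg n) Sv.
move: h2 hn; rewrite (nrm_dist (g n)) ltr_pdivlMr// => h2 hn.
by have := nrm_ge0 (v - g n); nra.
Qed.

(** The value [t v] is the limit of [h] along indices for which [g] tends to [v]. It satisfies
    [nrm (t v - h n) <= c * nrm (v - g n)] for all [n], and this inequality alone yields both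
    [t (g n) = h n] and the Lipschitz bound. *)
Lemma lipschitz_extension c g h : 0 <= c ->
  (forall v, S v -> adherent (range g) v) ->
  (forall n, S (g n)) -> (forall n, S (h n)) ->
  (forall m n, nrm (h m - h n) <= c * nrm (g m - g n)) ->
  exists t, [/\ forall v, S v -> S (t v), forall n, t (g n) = h n & lip_on c t].
Proof.
move=> c0 gd Sg Sh lip.
have c1 : 0 < c + 1 by rewrite ltr_wpDl.
have /choice[t ht] : forall v, exists w, S v ->
    S w /\ forall n, nrm (w - h n) <= c * nrm (v - g n).
  move=> v; have [Sv|] := pselect (S v); last by move=> nS; exists 0.
  have /choice[N hN] : forall k : nat, exists n, nrm (v - g n) < k.+1%:R^-1.
    move=> k; have [|_ [n _ <-] hn] := gd v Sv k.+1%:R^-1; last by exists n.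
    by rewrite invr_gt0 ltr0n.
  have ev e : 0 < e -> exists K, forall k, (K <= k)%N -> nrm (v - g (N k)) < e.
    move=> e0; have := near_infty_natSinv_lt (PosNum e0) => -[K _ hK].
    by exists K => k /hK /=; apply: lt_trans.
  have [e e0|w hw] := nrm_cauchy_cvg (u := fun k => h (N k)).
    (* The factor [2] accounts for the two distances to [v], and [c + 1] keeps the denominator
       positive when [c] is [0]. *)
    have e2 : 0 < e / (2 * (c + 1)) by rewrite divr_gt0// mulr_gt0.
    have [K hK] := ev _ e2; exists K => m n /hK hm /hK hn.
    apply: le_lt_trans (lip _ _) _.
    have := nrm_dist_trans v (g (N m)) (g (N n)).
    move: hm hn; rewrite (nrm_dist (g (N m)) v) !ltr_pdivlMr ?mulr_gt0//.
    by have := nrm_ge0 (g (N m) - g (N n)); nra.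
  exists w => _; split.
    apply: ((closed_adherent (cs_set S)).1 (@cs_closed _ _ S)) => e /hw[K hK].
    by exists (h (N K)) => //; exact: hK.
  move=> n; apply/ler_addgt0Pl => e e0.
  have e2 : 0 < e / (c + 1) by rewrite divr_gt0.
  have [K hK] := ev _ e2; have [M hM] := hw _ e2.
  have := hM _ (leq_maxl M K); have := hK _ (leq_maxr M K).
  set k := maxn M K; rewrite !ltr_pdivlMr// => h1 h2.
  have h3 := nrm_dist_trans (h (N k)) w (h n).
  have h4 := lip (N k) n.
  have := nrm_dist_trans v (g (N k)) (g n); rewrite (nrm_dist (g (N k)) v) => h5.
  have : c * nrm (g (N k) - g n) <= c * (nrm (v - g (N k)) + nrm (v - g n)).
    by rewrite ler_wpM2l.
  nra.
exists t; split.
- by move=> v /ht[].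
- move=> n; apply: eq_of_nrm => e e0; have [_ /(_ n)] := ht _ (Sg n).
  by rewrite subrr nrm0 mulr0 => /le_trans; apply; exact: ltW.
- move=> v w Sv Sw; apply/ler_addgt0Pl => e e0.
  have e2 : 0 < e / (2 * (c + 1)) by rewrite divr_gt0// mulr_gt0.
  have [_ [n _ <-]] := gd _ Sv _ e2; rewrite ltr_pdivlMr ?mulr_gt0// => hn.
  have [_ /(_ n) h1] := ht _ Sv; have [_ /(_ n) h2] := ht _ Sw.
  have h3 := nrm_dist_trans (h n) (t v) (t w).
  have h4 := nrm_dist_trans v w (g n).
  rewrite (nrm_dist (h n) (t w)) in h3; rewrite (nrm_dist w v) in h4.
  have : c * nrm (w - g n) <= c * (nrm (v - w) + nrm (v - g n)) by rewrite ler_wpM2l.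
  by have := nrm_ge0 (v - g n); nra.
Qed.

(** Every [k *: v + w] is a limit of combinations [ratC q *: g m + g n], and both sides are
    continuous. *)
Lemma lip_linear c t g : 0 <= c -> lip_on c t -> (forall n, S (g n)) ->
  (forall v, S v -> adherent (range g) v) ->
  (forall q m n, t (ratC q *: g m + g n) = ratC q *: t (g m) + t (g n)) ->
  forall (k : R[i]) v w, S v -> S w -> t (k *: v + w) = k *: t v + t w.
Proof.
move=> c0 lt Sg gd tg k v w Sv Sw; apply: eq_of_nrm => e e0.
(* The same scalar [q] has to approximate [k] well against [v] and against [t v], hence the sum. *)
have A0 : 0 <= nrm v + nrm (t v) by rewrite addr_ge0 ?nrm_ge0.
(* The error is at most [3 * c * d] for [t (k *: v + w)] and [d + 2 * c * d] for [k *: t v + t w],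
   in total at most [6 * (c + 1) * d]. *)
pose d := e / (6 * (c + 1)).
have d0 : 0 < d by rewrite divr_gt0// mulr_gt0// ltr_wpDl.
have [q [m [n [h1 h2 h3]]]] := @comb_approx g k v w _ _ A0 d0 (gd _ Sv) (gd _ Sw).
have k0 := Re_norm_ge0 (k - ratC q).
have q0 := Re_norm_ge0 (ratC q : R[i]).
apply: le_trans (nrm_dist_trans (t (ratC q *: g m + g n)) _ _) _.
rewrite (nrm_dist (t (ratC q *: g m + g n)) (k *: t v + t w)) tg.
have h4 := lt _ _ (csP k Sv Sw) (csP (ratC q) (Sg m) (Sg n)).
rewrite tg in h4.
have h5 := comb_dist k (ratC q) v w (g m) (g n).
have h6 := comb_dist k (ratC q) (t v) (t w) (t (g m)) (t (g n)).
have h7 : complex.Re `|ratC q| * nrm (t v - t (g m)) <= c * d.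
  apply: le_trans (ler_wpM2l q0 (lt _ _ Sv (Sg m))) _.
  by rewrite mulrCA ler_wpM2l.
have h8 : nrm (t w - t (g n)) <= c * d.
  by apply: le_trans (lt _ _ Sw (Sg n)) _; rewrite ler_wpM2l.
move: h1; rewrite mulrDr => h1.
have h9 : complex.Re `|k - ratC q| * nrm v <= d.
  by apply: le_trans h1; rewrite lerDl mulr_ge0 ?nrm_ge0.
have h10 : complex.Re `|k - ratC q| * nrm (t v) <= d.
  by apply: le_trans h1; rewrite lerDr mulr_ge0 ?nrm_ge0.
have h11 : c * nrm ((k *: v + w) - (ratC q *: g m + g n)) <= c * (3 * d).
  by rewrite ler_wpM2l//; lra.
have : e = 6 * (c + 1) * d by rewrite /d mulrC divfK// mulf_neq0// gt_eqF// ltr_wpDl.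
have : 0 <= c * d by rewrite mulr_ge0// ltW.
by lra.
Qed.

End LipschitzExtension.

(** * The fibres of a bounded operator that commutes with cuts *)

Section FiberOperators.
Context (R : realType) d (X : measurableType d) (mu : {measure set X -> \bar R}).
Hypothesis mu_complete : forall N, mu.-negligible N -> measurable N.
Context (H : X -> hilbertType R) (V : forall p, csub (H p)).
Context (G : hilbertType R) (ev : G -> forall p, H p).
Hypothesis hdi : direct_integral mu (fun p => cs_set (V p)) (setT : set G) ev.
Context (xs : nat -> G).
Hypothesis xs_dense : dense_seq xs.

(** The values at a point of a dense sequence of vectors need not be stable under rational
    combinations. It is enough that such combinations are adherent to them, which is true at almost
    every point. *)
Lemma adherent_csub (K : hilbertType R) (g : nat -> K) : adherent (range g) 0 ->
  (forall q m n, adherent (range g) (ratC q *: g m + g n)) ->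
  forall (k : R[i]) v w, adherent (range g) v -> adherent (range g) w ->
    adherent (range g) (k *: v + w).
Proof.
move=> g0 gq k v w hv hw; apply: adherent_adherent => e e0.
have e4 : 0 < e / 4 by rewrite divr_gt0.
have [q [m [n [h1 h2 h3]]]] := comb_approx k (nrm_ge0 v) e4 hv hw.
exists (ratC q *: g m + g n); first exact: gq.
by apply: le_lt_trans (comb_dist _ _ _ _ _ _) _; lra.
Qed.

(** Off a null set the closure [C] of the [x_n(p)] is a closed subspace of [V p]. For [v] in [V p],
    the difference [v - oproj C v] is orthogonal to all [x_n(p)], hence [0] by [fiber_total]. *)
Lemma fiber_dense : {ae mu, forall p, forall v, V p v ->
  adherent (range (fun n => ev (xs n) p)) v}.
Proof.
have h1 : {ae mu, forall p, forall i : (rat * rat) * nat * nat,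
    adherent (range (fun n => ev (xs n) p)) (ratC i.1.1 *: ev (xs i.1.2) p + ev (xs i.2) p)}.
  apply: ae_forall_countable => // -[[q m] n] /=.
  apply: filterS2 (fiber_adherent hdi xs_dense (ratC q *: xs m + xs n))
    (di_linear hdi (ratC q) (xs m) (xs n)).
  by move=> p + <-.
apply: filterS2 h1 (fiber_total mu_complete hdi xs_dense) => p h1 h2 v Vv.
set g := fun n => ev (xs n) p.
have g0 : adherent (range g) 0.
  (* Coefficient [-1] and both indices [0] give the combination [- g 0 + g 0]. *)
  have := h1 ((-1, 0), 0%N, 0%N) => /=.
  rewrite (_ : ratC (-1, 0) = -1 :> R[i]) ?scaleN1r ?addNr//.
  by rewrite /ratC /= rmorphN1 rmorph0; apply/eqP; rewrite eq_complex /= oppr0 !eqxx.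
have gP := adherent_csub g0 (fun q m n => h1 (q, m, n)).
have gC : closed (adherent (range g)) by apply/closed_adherent => x /adherent_adherent.
pose C := CSub g0 gP gC.
have CV x : C x -> V p x.
  move=> hx; apply: ((closed_adherent (cs_set (V p))).1 (@cs_closed _ _ (V p))).
  by apply: adherentS hx => _ [n _ <-]; exact: (di_in hdi).
suff /eqP : v - oproj C v = 0 by rewrite subr_eq0 => /eqP ->; exact: (oproj_in C).
apply: h2 => [|n].
  by apply: csB => //; apply: CV; exact: oproj_in.
apply: (oproj_perp (S := C)); move=> e e0; exists (g n); first by exists n.
by rewrite subrr nrm0.
Qed.

Context (T : G -> G) (c : R).
Hypothesis c0 : 0 <= c.
Hypothesis Tlin : linear T.
Hypothesis Tc : forall x, nrm (T x) <= c * nrm x.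
Hypothesis Tcut : commutes_cuts hdi T.

(** All conditions bear on [V p] only. Where the [x_n(p)] are dense in [V p], [fo_lip] and [fo_seq]
    determine [t] there. *)
Record fiber_op p (t : H p -> H p) : Prop := FiberOp {
  fo_in : forall v, V p v -> V p (t v);
  fo_lin : forall (k : R[i]) v w, V p v -> V p w -> t (k *: v + w) = k *: t v + t w;
  fo_lip : lip_on (V p) c t;
  fo_seq : forall n, t (ev (xs n) p) = ev (T (xs n)) p
}.

Lemma di_sub x y : {ae mu, forall p, ev (x - y) p = ev x p - ev y p}.
Proof.
have := di_linear hdi (-1) y x; apply: filterS => p.
by rewrite !scaleN1r addrC (addrC _ (ev x p)).
Qed.

Lemma fiber_lipschitz x y :
  {ae mu, forall p, nrm (ev (T x) p - ev (T y) p) <= c * nrm (ev x p - ev y p)}.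
Proof.
have h := fiber_bound c0 Tc Tcut (x - y).
near=> p.
have <- : ev (x - y) p = ev x p - ev y p by near: p; exact: di_sub.
have <- : ev (T x - T y) p = ev (T x) p - ev (T y) p by near: p; exact: di_sub.
by rewrite -(op_linearB Tlin); near: p.
Unshelve. all: by end_near. Qed.

(** The quantifier over [t] is inside the almost-everywhere statement, so the null set depends on
    [u] but not on [t]. Only the Lipschitz bound is used on [t], because its linearity is deduced
    from this lemma. *)
Lemma fiber_lip_eval u : {ae mu, forall p, forall t, lip_on (V p) c t ->
  (forall n, t (ev (xs n) p) = ev (T (xs n)) p) -> t (ev u p) = ev (T u) p}.
Proof.
have h := ae_foralln (fun n => fiber_lipschitz u (xs n)).
apply: filterS2 h (fiber_adherent hdi xs_dense u) => p h1 h2 t lt tn.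
apply: eq_of_nrm => e e0.
have c1 : 0 < 2 * (c + 1) by rewrite mulr_gt0// ltr_wpDl.
have [_ [n _ <-]] := h2 _ (divr_gt0 e0 c1); rewrite ltr_pdivlMr// => hn.
apply: le_trans (nrm_dist_trans (t (ev (xs n) p)) _ _) _.
have h3 := lt _ _ (di_in hdi u p) (di_in hdi (xs n) p).
have h4 := h1 n; rewrite nrm_dist -tn in h4.
by have := nrm_ge0 (ev u p - ev (xs n) p); nra.
Qed.

Lemma fiber_op_eval u : {ae mu, forall p, forall t : H p -> H p, fiber_op t ->
  t (ev u p) = ev (T u) p}.
Proof. by apply: filterS (fiber_lip_eval u) => p h t [_ _ lt tn]; exact: h. Qed.

(** The Lipschitz extension of [x_n(p) |-> (T x_n)(p)] exists by [fiber_lipschitz]. Evaluating it at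
    the vectors [ratC q *: x_m + x_n], countably many, shows that it respects rational combinations,
    and [lip_linear] does the rest. *)
Lemma fiber_op_exists : {ae mu, forall p, exists t : H p -> H p, fiber_op t}.
Proof.
have h1 : {ae mu, forall p, forall i : (rat * rat) * nat * nat,
    forall t, lip_on (V p) c t -> (forall n, t (ev (xs n) p) = ev (T (xs n)) p) ->
    t (ratC i.1.1 *: ev (xs i.1.2) p + ev (xs i.2) p) =
    ratC i.1.1 *: t (ev (xs i.1.2) p) + t (ev (xs i.2) p)}.
  apply: ae_forall_countable => // -[[q m] n] /=.
  have e1 := di_linear hdi (ratC q) (xs m) (xs n).
  have e2 := di_linear hdi (ratC q) (T (xs m)) (T (xs n)).
  have e3 := fiber_lip_eval (ratC q *: xs m + xs n).
  apply: filterS3 e1 e2 e3 => p e1 e2 e3 t lt tn.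
  by rewrite -e1 e3// Tlin e2 !tn.
have h2 : {ae mu, forall p, forall i : nat * nat, nrm (ev (T (xs i.1)) p - ev (T (xs i.2)) p)
    <= c * nrm (ev (xs i.1) p - ev (xs i.2) p)}.
  by apply: ae_forall_countable => // i; exact: fiber_lipschitz.
apply: filterS3 h1 h2 fiber_dense => p h1 h2 h3.
have [t [tV tn lt]] := @lipschitz_extension _ _ (V p) c (fun n => ev (xs n) p)
  (fun n => ev (T (xs n)) p) c0 h3 (fun n => di_in hdi _ p)
  (fun n => di_in hdi _ p) (fun m n => h2 (m, n)).
exists t; split => //.
apply: (lip_linear (c := c) (g := fun n => ev (xs n) p)) => //.
  by move=> n; exact: (di_in hdi).
by move=> q m n; exact: (h1 (q, m, n)).
Qed.

End FiberOperators.

(** * Gluing operators on a locally Hilbert space *)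

Section Gluing.
Context (R : realType) (d : Order.disp_t) (L : directedType d).
Context (H : hilbertType R) (E : ind_system L H).
Implicit Types (a b : L).

Definition csub_of a : csub H :=
  CSub (ind_space0 E a) (@ind_spaceP _ _ _ _ E a) (ind_closed (i := E) (a := a)).

Lemma in_unionP (h : H) : reflect (ind_union E h) (h \in in_union E).
Proof. exact: asboolP. Qed.

Definition inL (h : H) : locHilbert E := odflt 0 (insub h).

Lemma inLK a h : E a h -> lh_val (inL h) = h.
Proof.
move=> Eh; rewrite /inL; case: insubP => [u _ //|/negP[]].
by apply/in_unionP; exists a.
Qed.

Lemma lh_inj (u v : locHilbert E) : lh_val u = lh_val v -> u = v.
Proof. exact: val_inj. Qed.

Lemma lh_in (u : locHilbert E) : exists a, E a (lh_val u).
Proof. by have /in_unionP[a _ Ea] := lh_valP u; exists a. Qed.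

Lemma lh_valK (u : locHilbert E) : inL (lh_val u) = u.
Proof. by have [a Ea] := lh_in u; apply: lh_inj; exact: inLK Ea. Qed.

(** [T u] is computed with any index whose subspace contains [u]; directedness and compatibility
    make the choice immaterial. Commutation with the projections becomes stability of the orthogonal
    complements. The lemma serves both in the fibres and in the global space. *)
Lemma glue_exists (t : L -> H -> H) :
  (forall a v, E a v -> E a (t a v)) ->
  (forall a (k : R[i]) v w, E a v -> E a w -> t a (k *: v + w) = k *: t a v + t a w) ->
  (forall a, exists c : R, forall v, E a v -> nrm (t a v) <= c * nrm v) ->
  (forall a b v, (a <= b)%O -> E a v -> t b v = t a v) ->
  (forall a b v, (a <= b)%O -> E b v ->
     oproj (csub_of a) (t b v) = t b (oproj (csub_of a) v)) ->
  exists T : locHilbert E -> locHilbert E, loc_bounded_op T /\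
    forall a u, E a (lh_val u) -> lh_val (T u) = t a (lh_val u).
Proof.
move=> tE tl tc tab tp.
pose T (u : locHilbert E) := inL (t (projT1 (cid (lh_in u))) (lh_val u)).
have TE a u : E a (lh_val u) -> lh_val (T u) = t a (lh_val u).
  move=> Eu; rewrite /T; case: cid => b Ebu /=; rewrite (inLK (tE _ _ Ebu)).
  by have [c [ac bc]] := directed_ub a b; rewrite -(tab _ _ _ ac Eu) -(tab _ _ _ bc Ebu).
exists T; split=> //; split.
  move=> k u v; apply: lh_inj => /=.
  have [a Ea] := lh_in u; have [b Eb] := lh_in v.
  have [c [ac bc]] := directed_ub a b.
  have Ecu := ind_mono ac Ea; have Ecv := ind_mono bc Eb.
  rewrite (TE c (k *: u + v)) /=; last exact: ind_spaceP.
  by rewrite (TE c u)// (TE c v)// tl.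
move=> a; split.
- by move=> u Eu; rewrite (TE a)//; exact: tE.
- move=> u pu; have [b Eb] := lh_in u; have [c [ac bc]] := directed_ub a b.
  have Ecu := ind_mono bc Eb; rewrite (TE c)//.
  apply: (oproj_eq0P (S := csub_of a)); rewrite (tp _ _ _ ac Ecu).
  rewrite (oproj_eq0 (S := csub_of a) pu).
  have := tl c (-1) 0 0 (ind_space0 _ _) (ind_space0 _ _).
  by rewrite !scaleN1r oppr0 addr0 addNr.
- have [c hc] := tc a; exists c%:C%C => u Eu.
  by rewrite (TE a)// !nrmE -rmorphM lecR; exact: hc.
Qed.

End Gluing.

(** * The projective system *)

Section System.
Context (R : realType) (d : Order.disp_t) (L : directedType d).
Context d' (X : measurableType d') (mu : {measure set X -> \bar R}).
Hypothesis mu_complete : forall N, mu.-negligible N -> measurable N.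
Context (Q : X -> quantized_domain R L) (D : loc_direct_integral mu Q).
Implicit Types (a b c : L) (B : set X).

Let K := ldi_space D.
Let E a : csub K := csub_of (ldi_sys D) a.
Let V a p : csub (Q p) := csub_of (qd_sys (Q p)) a.

Definition comp_space a : hilbertType R := subH (E a).

(** [ldi_sev a] is used because its values lie in [H_{a,p}] at every [p], whereas those of [ldi_ev]
    are only known to do so almost everywhere. *)
Definition comp_ev a (x : comp_space a) p : Q p := ldi_sev a (sval_of x) p.

Lemma comp_mono a b x : (a <= b)%O -> E a x -> E b x.
Proof. by move=> ab; exact: ind_mono ab _. Qed.

Lemma fib_mono a b p v : (a <= b)%O -> V a p v -> V b p v.
Proof. by move=> ab; exact: ind_mono ab _. Qed.

Definition toE a (h : K) : comp_space a := inS (E a) h.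

Lemma toEK a h : E a h -> sval_of (toE a h) = h.
Proof. exact: inSK. Qed.

Lemma toE_val a (x : comp_space a) : toE a (sval_of x) = x.
Proof. exact: sval_ofK. Qed.

Lemma comp_di a :
  direct_integral mu (fun p => cs_set (V a p)) (setT : set (comp_space a)) (@comp_ev a).
Proof.
have [h1 h2 h3 h4] := ldi_sub D a; split.
- by move=> x _ p; apply: h1; exact: subH_in.
- by move=> x y _ _; apply: h2; exact: subH_in.
- by move=> x y _ _; rewrite subH_dotpE; apply: h3; exact: subH_in.
- move=> f fV hf; have [|x Ex hx] := h4 f fV.
    by move=> y Ey; have := hf (toE a y) I; rewrite /comp_ev toEK.
  by exists (toE a x) => //; rewrite /comp_ev toEK.
Qed.

Lemma comp_evE a (x : comp_space a) :
  {ae mu, forall p, comp_ev x p = ldi_ev (sval_of x) p}.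
Proof. exact/ldi_sevE/subH_in. Qed.

Lemma comp_ev_eq a b (x : comp_space a) (y : comp_space b) : sval_of x = sval_of y ->
  {ae mu, forall p, comp_ev x p = comp_ev y p}.
Proof.
by move=> xy; apply: filterS2 (comp_evE x) (comp_evE y) => p -> ->; rewrite xy.
Qed.

(** Meant for [c <= a]; otherwise the projection may leave [E a], and [toE] then returns [0]. *)
Definition cproj a c (x : comp_space a) : comp_space a := toE a (oproj (E c) (sval_of x)).

Lemma cprojE a c x : (c <= a)%O -> sval_of (@cproj a c x) = oproj (E c) (sval_of x).
Proof. by move=> ca; apply: toEK; apply: (comp_mono ca); exact: oproj_in. Qed.

(* [comp_alg a] consists of the decomposable operators that reduce every [E c],
   [c <= a]. *)
Definition comp_gen a : set (comp_space a -> comp_space a) :=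
  [set P | (exists2 B, measurable B & P = dicut (comp_di a) B) \/
           (exists2 c, (c <= a)%O & P = @cproj a c)].

Definition comp_alg a := commutant (@comp_gen a).

Lemma comp_alg_vN a : von_neumann_algebra (@comp_alg a).
Proof.
apply: commutant_vN => P [[B mB ->] x y|[c ca ->] x y]; first exact: dicut_sym.
by rewrite !subH_dotpE !cprojE// oproj_sym.
Qed.

Lemma comp_alg_cut a T : @comp_alg a T -> commutes_cuts (comp_di a) T.
Proof. by move=> [_ h] B mB x; apply: h; left; exists B. Qed.

Lemma comp_alg_proj a c T : @comp_alg a T -> (c <= a)%O ->
  forall x, T (cproj c x) = cproj c (T x).
Proof. by move=> [_ h] ca x; apply: h; right; exists c. Qed.

Lemma comp_algP a (T : comp_space a -> comp_space a) : bounded_op T ->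
  commutes_cuts (comp_di a) T ->
  (forall c, (c <= a)%O -> forall x, T (cproj c x) = cproj c (T x)) -> comp_alg T.
Proof. by move=> bT Tc Tp; split => // P [[B mB ->]|[c ca ->]] x; [exact: Tc|exact: Tp]. Qed.

Lemma comp_alg_bound a T : @comp_alg a T ->
  linear T /\ exists c : R, 0 <= c /\ forall x, nrm (T x) <= c * nrm x.
Proof. by move=> [/bounded_opP]. Qed.

Definition comp_res a b (T : comp_space b -> comp_space b) : comp_space a -> comp_space a :=
  fun x => toE a (sval_of (T (toE b (sval_of x)))).

Lemma comp_alg_stable a b T (x : comp_space b) : (a <= b)%O -> comp_alg T ->
  E a (sval_of x) -> E a (sval_of (T x)).
Proof.
move=> ab hT Ex; have -> : x = cproj a x.
  by apply: val_inj; rewrite /= cprojE// oproj_id.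
by rewrite (comp_alg_proj hT)// cprojE//; exact: oproj_in.
Qed.

Lemma inclE a b (x : comp_space a) : (a <= b)%O -> sval_of (toE b (sval_of x)) = sval_of x.
Proof. by move=> ab; apply: toEK; apply: (comp_mono ab); exact: subH_in. Qed.

Lemma comp_resE a b T x : (a <= b)%O -> @comp_alg b T ->
  sval_of (comp_res (a := a) T x) = sval_of (T (toE b (sval_of x))).
Proof.
move=> ab hT; apply: toEK; apply: (comp_alg_stable ab hT).
by rewrite inclE//; exact: subH_in.
Qed.

(** Both vectors have the function equal to [x(p)] on [B] and [0] elsewhere, up to a null set. *)
Lemma dicut_incl a b B (x : comp_space a) : (a <= b)%O -> measurable B ->
  sval_of (dicut (comp_di b) B (toE b (sval_of x))) = sval_of (dicut (comp_di a) B x).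
Proof.
move=> ab mB; rewrite -(inclE (dicut (comp_di a) B x) ab); congr sval_of; apply: (di_ext (comp_di b)).
near=> p.
have -> : comp_ev (dicut (comp_di b) B (toE b (sval_of x))) p =
          if p \in B then comp_ev (toE b (sval_of x)) p else 0.
  by near: p; exact: dicutE.
have -> : comp_ev (toE b (sval_of (dicut (comp_di a) B x))) p = comp_ev (dicut (comp_di a) B x) p.
  by near: p; apply: comp_ev_eq; exact: inclE.
have -> : comp_ev (dicut (comp_di a) B x) p = if p \in B then comp_ev x p else 0.
  by near: p; exact: dicutE.
suff -> : comp_ev (toE b (sval_of x)) p = comp_ev x p by [].
by near: p; apply: comp_ev_eq; exact: inclE.
Unshelve. all: by end_near. Qed.

Lemma incl_lin a b (k : R[i]) (x y : comp_space a) : (a <= b)%O ->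
  toE b (sval_of (k *: x + y)) = k *: toE b (sval_of x) + toE b (sval_of y).
Proof. by move=> ab; apply: val_inj; rewrite [LHS]inclE//= !inclE. Qed.

Lemma comp_res_normal a b : (a <= b)%O ->
  normal_star_hom (@comp_alg b) (@comp_alg a) (@comp_res a b).
Proof.
move=> ab; split.
- move=> T hT; have [Tl [c [c0 hc]]] := comp_alg_bound hT; apply: comp_algP.
  + apply/bounded_opP; split.
      by move=> k x y; apply: val_inj => /=; rewrite !comp_resE// incl_lin// Tl.
    exists c; split=> // x; rewrite -nrm_val comp_resE// nrm_val.
    by apply: le_trans (hc _) _; rewrite -nrm_val inclE.
  + move=> B mB x; apply: val_inj => /=; rewrite comp_resE//.
    rewrite -(dicut_incl (comp_res T x) ab mB) -(dicut_incl x ab mB) toE_val.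
    rewrite (comp_alg_cut hT)//; congr (sval_of (dicut _ _ _)).
    by apply: val_inj; rewrite /= inclE// comp_resE.
  + move=> e ea x; apply: val_inj => /=; rewrite comp_resE// [RHS]cprojE// comp_resE//.
    rewrite -cprojE ?(le_trans ea)// -(comp_alg_proj hT) ?(le_trans ea)//.
    congr (sval_of (T _)); apply: val_inj => /=.
    by rewrite inclE// !cprojE ?(le_trans ea)// inclE.
- move=> k T S hT hS; apply/funext => x; apply: val_inj => /=.
  rewrite comp_resE//; last exact: (vN_lin (comp_alg_vN b)).
  by rewrite !fctE /= !comp_resE.
- move=> T S hT hS; apply/funext => x; apply: val_inj => /=.
  rewrite comp_resE//; last exact: (vN_comp (comp_alg_vN b)).
  by rewrite !comp_resE//= toE_val.
- move=> T S hT hS TS x y; rewrite !subH_dotpE !comp_resE//.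
  by have := TS (toE b (sval_of x)) (toE b (sval_of y)); rewrite !subH_dotpE !inclE.
(* Normality: a vector functional of the restriction to [G_a] is the vector functional of the
   operator itself for the same sequences seen in [G_b]. *)
- move=> F FF FM T hT hF x y xs ys.
  pose x' n := toE b (sval_of (x n)); pose y' n := toE b (sval_of (y n)).
  have ss (z : nat -> comp_space a) : square_summable z ->
      square_summable (fun n => toE b (sval_of (z n))).
    rewrite /square_summable.
    suff -> : (fun n => complex.Re `|toE b (sval_of (z n))| ^+ 2) =
              (fun n => complex.Re `|z n| ^+ 2) by [].
    by apply/funext => n; rewrite !subH_normE inclE.
  have form S : comp_alg S -> sigma_weak_form x y (comp_res (a := a) S) = sigma_weak_form x' y' S.
    move=> hS; rewrite /sigma_weak_form; congr (limn (series _)); apply/funext => n.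
    by rewrite !subH_dotpE comp_resE// inclE.
  have := hF x' y' (ss _ xs) (ss _ ys); rewrite -(form _ hT); apply: cvg_trans.
  apply: (@near_eq_cvg _ _ F _ (sigma_weak_form x' y')
    (sigma_weak_form x y \o @comp_res a b)).
  by apply: filterS FM => S hS; rewrite /= form.
Qed.

Lemma comp_res_id a T : @comp_alg a T -> comp_res (a := a) T = T.
Proof. by move=> hT; apply/funext => x; rewrite /comp_res !toE_val. Qed.

Lemma comp_res_trans a b c : (a <= b)%O -> (b <= c)%O -> forall T, @comp_alg c T ->
  comp_res (a := a) (comp_res (a := b) T) = comp_res (a := a) T.
Proof.
move=> ab bc T hT; apply/funext => x; apply: val_inj => /=.
have hb := nsh_maps (comp_res_normal bc) hT.
rewrite comp_resE// comp_resE// inclE// comp_resE//; exact: le_trans bc.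
Qed.

Definition comp_system : vN_system R L :=
  VNSystem comp_alg_vN comp_res_normal comp_res_id comp_res_trans.

End System.

(** * Decomposability of the elements of the limit *)

Section Decomposition.
Context (R : realType) (d : Order.disp_t) (L : directedType d).
Context d' (X : measurableType d') (mu : {measure set X -> \bar R}).
Hypothesis mu_complete : forall N, mu.-negligible N -> measurable N.
(* The only use of the alternative between countable [L] and counting [mu]. *)
Hypothesis ae_forall : forall P : L -> X -> Prop,
  (forall a, {ae mu, forall p, P a p}) -> {ae mu, forall p, forall a, P a p}.
Context (Q : X -> quantized_domain R L) (D : loc_direct_integral mu Q).
Implicit Types (a b c : L) (B : set X).

Let K := ldi_space D.
Let E a : csub K := csub_of (ldi_sys D) a.
Let V a p : csub (Q p) := csub_of (qd_sys (Q p)) a.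
Let G := comp_space D.

Lemma dense_seq_exists : exists ys : nat -> K, dense_seq ys.
Proof.
have [A cA dA] := ldi_separable D.
have dA' (u : K) (e : R) : 0 < e -> exists2 y, A y & nrm (u - y) < e.
  move=> e0; pose U := interior (ball u e%:C%C).
  have U0 : U !=set0 by exists u; apply/nbhs_nrm; exists e => // y; rewrite ball_nrmE.
  have [y [Uy Ay]] := dA U U0 (@open_interior _ _).
  by exists y => //; rewrite -ball_nrmE; exact: interior_subset.
have [f finj] := countable_injP _ cA.
have /choice[ys hys] : forall n, exists y, forall z, A z -> f z = n -> y = z.
  move=> n; have [[z [Az fz]]|no] := pselect (exists z, A z /\ f z = n).
    by exists z => w Aw fw; apply: finj; rewrite ?inE// fz fw.
  by exists 0 => z Az fz; case: no; exists z.
exists ys => u e e0; have [y Ay hy] := dA' u e e0.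
by exists (f y); rewrite (hys _ y).
Qed.

Let ys := projT1 (cid dense_seq_exists).

(** Projections are contractions that fix their range, so one dense sequence of the whole space
    gives a dense sequence in every [G a]. *)
Definition comp_seq a n : G a := toE a (oproj (E a) (ys n)).

Lemma comp_seq_dense a : dense_seq (comp_seq a).
Proof.
move=> u e e0; have [n hn] := projT2 (cid dense_seq_exists) (sval_of u) e e0.
exists n; apply: le_lt_trans hn; rewrite -nrm_val /= toEK; last exact: oproj_in.
rewrite -{1}(oproj_id (S := E a) (x := sval_of u)); last exact: subH_in.
by rewrite -oprojB; exact: oproj_nrm.
Qed.

(** The fibrewise projection [f] of [x] has the same inner products as [x] with the vectors of
    [G a]. So it is the function of some [z] in [G a], and [x - z] is orthogonal to [G a]. The two
    functions of [y], in [G a] and in [G b], agree only almost everywhere, hence the appeal to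
    completeness of [mu]. *)
Lemma fiber_proj a b (x : G b) : (a <= b)%O ->
  {ae mu, forall p, comp_ev (cproj a x) p = oproj (V a p) (comp_ev x p)}.
Proof.
move=> ab; pose f p := oproj (V a p) (comp_ev x p).
have fV p : V a p (f p) by exact: oproj_in.
have fE (y : G a) p : '<<f p, comp_ev y p>> = '<<comp_ev x p, comp_ev y p>>.
  by rewrite oproj_sym oproj_id//; exact: (di_in (comp_di D a)).
have fE' (y : G a) :
    {ae mu, forall p, '<<comp_ev x p, comp_ev (toE b (sval_of y)) p>> = '<<f p, comp_ev y p>>}.
  have : {ae mu, forall p, comp_ev (toE b (sval_of y)) p = comp_ev y p}.
    by apply: comp_ev_eq; exact: inclE.
  by apply: filterS => p ->; rewrite fE.
have [y _|z _ hz] := di_complete (comp_di D a) fV.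
  have [hr hi] := di_Cint (comp_di D b) x (toE b (sval_of y)).
  split.
    by apply: (rintegrable_ae_complete mu_complete hr); apply: filterS (fE' y) => p ->.
  by apply: (rintegrable_ae_complete mu_complete hi); apply: filterS (fE' y) => p ->.
suff zE : sval_of z = sval_of (cproj a x).
  by apply: filterS2 hz (comp_ev_eq zE) => p hz1 <-.
rewrite cprojE//; apply/esym/oproj_unique; first exact: subH_in.
move=> y Ey; rewrite dotpBl; apply/eqP; rewrite subr_eq0; apply/eqP.
pose y' := toE a y; have yE : sval_of y' = y by exact: toEK.
rewrite -{2}yE -subH_dotpE -yE -(inclE y' ab) -subH_dotpE.
rewrite (di_dotpE (comp_di D b)) (di_dotpE (comp_di D a)).
apply: C_integral_ae; [exact: (di_Cint (comp_di D b))|exact: (di_Cint (comp_di D a))|].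
by apply: filterS2 (fE' y') hz => p -> ->.
Qed.

(** * From a compatible family of operators to a decomposable operator *)

Section FromLimit.
Context (z : forall a, G a -> G a).
Hypothesis z_alg : forall a, comp_alg (@z a).
Hypothesis z_res : forall a b, (a <= b)%O -> comp_res (a := a) (@z b) = @z a.

Lemma limit_val a b (x : G a) : (a <= b)%O ->
  sval_of (z (toE b (sval_of x))) = sval_of (z x).
Proof. by move=> ab; rewrite -(z_res ab) comp_resE. Qed.

Let bnd a : exists c : R, 0 <= c /\ forall x, nrm (@z a x) <= c * nrm x :=
  (comp_alg_bound (z_alg a)).2.

Let cst a : R := projT1 (cid (bnd a)).

Let cst_ge0 a : 0 <= cst a.
Proof. by rewrite /cst; case: cid => c []. Qed.

Let cst_bound a x : nrm (@z a x) <= cst a * nrm x.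
Proof. by rewrite /cst; case: cid => c []. Qed.

Definition limit_fiber a p (t : Q p -> Q p) : Prop :=
  fiber_op (H := Q) (V a) (@comp_ev _ _ _ _ _ _ _ D a) (comp_seq a) (@z a) (cst a) t.

Lemma limit_fiber_exists : {ae mu, forall p, forall a, exists t, limit_fiber a (p := p) t}.
Proof.
apply: ae_forall => a; have [zl _] := comp_alg_bound (z_alg a).
exact: (fiber_op_exists mu_complete (hdi := comp_di D a) (@comp_seq_dense a) (cst_ge0 a) zl
  (@cst_bound a) (comp_alg_cut (z_alg a))).
Qed.

Lemma limit_fiber_eval a (u : G a) : {ae mu, forall p, forall t : Q p -> Q p,
  limit_fiber a t -> t (comp_ev u p) = comp_ev (z u) p}.
Proof.
have [zl _] := comp_alg_bound (z_alg a).
exact: (fiber_op_eval (hdi := comp_di D a) (@comp_seq_dense a) (cst_ge0 a) zl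
  (@cst_bound a) (comp_alg_cut (z_alg a))).
Qed.

Lemma limit_fiber_dense a : {ae mu, forall p, forall v, V a p v ->
  adherent (range (fun n => comp_ev (comp_seq a n) p)) v}.
Proof. exact: (fiber_dense mu_complete (comp_di D a) (@comp_seq_dense a)). Qed.

(** Two Lipschitz maps on [V a p] that agree on the dense sequence [x_n(p)], because [z b] extends
    [z a]. *)
Lemma limit_fiber_res a b : (a <= b)%O -> {ae mu, forall p, forall t s : Q p -> Q p,
  limit_fiber a t -> limit_fiber b s -> forall v, V a p v -> s v = t v}.
Proof.
move=> ab.
have h1 : {ae mu, forall p, forall n, forall s : Q p -> Q p, limit_fiber b s ->
    s (comp_ev (comp_seq a n) p) = comp_ev (z (comp_seq a n)) p}.
  apply: ae_foralln => n; set x := comp_seq a n.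
  have e1 := comp_ev_eq (inclE x ab).
  have e2 := comp_ev_eq (limit_val x ab).
  apply: filterS3 e1 e2 (limit_fiber_eval (toE b (sval_of x))) => p e1 e2 e3 s hs.
  by rewrite -e1 -e2 e3.
apply: filterS2 h1 (limit_fiber_dense a) => p h1 h2 t s ht hs v Vv.
apply: (lip_eq (S := V a p) (cst_ge0 b) (cst_ge0 a) _ (fo_lip ht) _ _ Vv (h2 v Vv)).
- by move=> x y Vx Vy; apply: (fo_lip hs); exact: fib_mono ab _.
- by move=> n; exact: (di_in (comp_di D a)).
- by move=> n; rewrite (fo_seq ht) h1.
Qed.

(** Again two Lipschitz maps, now on [V b p]. They agree on the dense sequence because [z b]
    commutes with [cproj a], which acts fibrewise by [fiber_proj]. *)
Lemma limit_fiber_proj a b : (a <= b)%O -> {ae mu, forall p, forall s : Q p -> Q p,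
  limit_fiber b s -> forall v, V b p v -> oproj (V a p) (s v) = s (oproj (V a p) v)}.
Proof.
move=> ab.
have h1 : {ae mu, forall p, forall n, forall s : Q p -> Q p, limit_fiber b s ->
    oproj (V a p) (s (comp_ev (comp_seq b n) p)) = s (oproj (V a p) (comp_ev (comp_seq b n) p))}.
  apply: ae_foralln => n; set x := comp_seq b n.
  have e1 := fiber_proj x ab; have e2 := fiber_proj (z x) ab.
  have e3 := limit_fiber_eval x; have e4 := limit_fiber_eval (cproj a x).
  rewrite (comp_alg_proj (z_alg b) ab) in e4.
  near=> p => s hs; rewrite (_ : s (comp_ev x p) = comp_ev (z x) p); last first.
    by move: s hs; near: p.
  have <- : comp_ev (cproj a (z x)) p = oproj (V a p) (comp_ev (z x) p) by near: p.
  have <- : comp_ev (cproj a x) p = oproj (V a p) (comp_ev x p) by near: p.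
  by apply/esym; move: s hs; near: p.
apply: filterS2 h1 (limit_fiber_dense b) => p h1 h2 s hs v Vv.
have sub w : V b p (oproj (V a p) w) by apply: (fib_mono ab); exact: oproj_in.
apply: (lip_eq (S := V b p) (t := fun w => oproj (V a p) (s w))
  (t' := fun w => s (oproj (V a p) w)) (cst_ge0 b) (cst_ge0 b) _ _ _ _ Vv (h2 v Vv)).
- move=> x y Vx Vy; rewrite -oprojB; apply: le_trans (oproj_nrm _ _) _.
  exact: (fo_lip hs).
- move=> x y Vx Vy; apply: le_trans (fo_lip hs (sub _) (sub _)) _.
  by rewrite ler_wpM2l// -oprojB; exact: oproj_nrm.
- by move=> n; exact: (di_in (comp_di D b)).
- by move=> n; exact: h1.
Unshelve. all: by end_near. Qed.

Lemma limit_decomposable (T : locHilbert (ldi_sys D) -> locHilbert (ldi_sys D)) :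
  (forall a u, ldi_sys D a (lh_val u) -> lh_val (T u) = sval_of (z (toE a (lh_val u)))) ->
  decomposable T.
Proof.
move=> TE.
(* What gluing at [p] requires. The relations range over all fibre operators rather than a chosen
   family, so that the null set is fixed before any choice. *)
pose good p := [/\ forall a, exists t, limit_fiber a (p := p) t,
  forall a b, (a <= b)%O -> forall t s : Q p -> Q p, limit_fiber a t -> limit_fiber b s ->
    forall v, V a p v -> s v = t v &
  forall a b, (a <= b)%O -> forall s : Q p -> Q p, limit_fiber b s ->
    forall v, V b p v -> oproj (V a p) (s v) = s (oproj (V a p) v)].
have ae_good : {ae mu, forall p, good p}.
  have h2 : {ae mu, forall p, forall a b, (a <= b)%O -> forall t s : Q p -> Q p,
      limit_fiber a t -> limit_fiber b s -> forall v, V a p v -> s v = t v}.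
    apply: ae_forall => a; apply: ae_forall => b.
    have [ab|nab] := boolP (a <= b)%O; last exact: nearW.
    by apply: filterS (limit_fiber_res ab) => p h _.
  have h3 : {ae mu, forall p, forall a b, (a <= b)%O -> forall s : Q p -> Q p,
      limit_fiber b s -> forall v, V b p v -> oproj (V a p) (s v) = s (oproj (V a p) v)}.
    apply: ae_forall => a; apply: ae_forall => b.
    have [ab|nab] := boolP (a <= b)%O; last exact: nearW.
    by apply: filterS (limit_fiber_proj ab) => p h _.
  by apply: filterS3 limit_fiber_exists h2 h3 => p g1 g2 g3.
have Tp_exists : forall p, exists Tp : locHilbert (qd_sys (Q p)) -> locHilbert (qd_sys (Q p)),
    loc_bounded_op Tp /\ (good p -> forall a (t : Q p -> Q p), limit_fiber a t ->
      forall w, V a p (lh_val w) -> lh_val (Tp w) = t (lh_val w)).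
  move=> p; have [[g1 g2 g3]|ng] := pselect (good p); last first.
    (* The family must be defined at every [p]; at the exceptional points it is [0]. *)
    exists (fun=> 0); split=> //; split; first by move=> k u v; rewrite scaler0 addr0.
    move=> a; split => /=.
    - by move=> u _; exact: ind_space0.
    - by move=> u _ y _; exact: dot0p.
    - by exists 0 => u _; rewrite mul0r normr0.
  have /choice[t ht] := g1.
  have [|||||Tp [bT TpE]] := @glue_exists _ _ _ _ (qd_sys (Q p)) t.
  - by move=> a v; exact: (fo_in (ht a)).
  - by move=> a k v w; exact: (fo_lin (ht a)).
  - move=> a; exists (cst a) => v Vv.
    have t0 : t a 0 = 0.
      have := fo_lin (ht a) (-1) (cs0 (V a p)) (cs0 (V a p)).
      by rewrite !scaleN1r oppr0 addr0 addNr.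
    by have := fo_lip (ht a) Vv (cs0 (V a p)); rewrite t0 !subr0.
  - by move=> a b v ab Vv; exact: (g2 a b ab _ _ (ht a) (ht b)).
  - by move=> a b v ab Vv; exact: (g3 a b ab _ (ht b)).
  (* [t'] may differ from the chosen [t a]; compatibility with both indices equal to [a] identifies
     them on [V a p]. *)
  exists Tp; split => // _ a t' ht' w Vw; rewrite (TpE a)//.
  exact: (g2 a a (le_refl a) _ _ ht' (ht a)).
pose Tp p := projT1 (cid (Tp_exists p)).
have hTp p := projT2 (cid (Tp_exists p)).
exists Tp => [p|u]; first exact: (hTp p).1.
have [a Eu] := lh_in u; pose x := toE a (lh_val u).
have xE : sval_of x = lh_val u by exact: toEK.
have e1 := comp_evE x; have e2 := comp_evE (z x); have e3 := limit_fiber_eval x.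
rewrite xE in e1; rewrite -(TE a u Eu) in e2.
apply: filterS2 ae_good (filterI e1 (filterI e2 e3)) => p gp [/= f1 [f2 f3]].
have Vx : V a p (comp_ev x p) by exact: (di_in (comp_di D a)).
exists (inL (qd_sys (Q p)) (comp_ev x p)); first by rewrite (inLK Vx).
have [g1 _ _] := gp; have [t ht] := g1 a.
by rewrite ((hTp p).2 gp a t ht) (inLK Vx)// (f3 t ht).
Qed.

End FromLimit.
End Decomposition.

(** * The isomorphism *)

Section Isomorphism.
Context (R : realType) (d : Order.disp_t) (L : directedType d).
Context d' (X : measurableType d') (mu : {measure set X -> \bar R}).
Hypothesis mu_complete : forall N, mu.-negligible N -> measurable N.
Hypothesis ae_forall : forall P : L -> X -> Prop,
  (forall a, {ae mu, forall p, P a p}) -> {ae mu, forall p, forall a, P a p}.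
Context (Q : X -> quantized_domain R L) (D : loc_direct_integral mu Q).
Implicit Types (a b c : L) (B : set X).

Let K := ldi_space D.
Let E a : csub K := csub_of (ldi_sys D) a.
Let G := comp_space D.
Let LH := locHilbert (ldi_sys D).
Let A := decomposable_algebra (D := D).
Implicit Types (T U : LH -> LH).

Definition restr T a (x : G a) : G a := toE a (lh_val (T (inL (ldi_sys D) (sval_of x)))).

Lemma comp_inL a (x : G a) : lh_val (inL (ldi_sys D) (sval_of x)) = sval_of x.
Proof. exact: (inLK (a := a) (subH_in x)). Qed.

Lemma restrE T a (x : G a) : loc_bounded_op T ->
  sval_of (restr T x) = lh_val (T (inL (ldi_sys D) (sval_of x))).
Proof.
move=> [_ /(_ a)[h _ _]]; apply: toEK; apply: h.
by rewrite comp_inL; exact: (subH_in x).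
Qed.

Lemma restr_toE T a (u : LH) : loc_bounded_op T -> ldi_sys D a (lh_val u) ->
  sval_of (restr T (toE a (lh_val u))) = lh_val (T u).
Proof. by move=> bT Eu; rewrite restrE// toEK// lh_valK. Qed.

Lemma inL_lin a (k : R[i]) (x y : G a) : inL (ldi_sys D) (sval_of (k *: x + y)) =
  k *: inL (ldi_sys D) (sval_of x) + inL (ldi_sys D) (sval_of y).
Proof. by apply: lh_inj; rewrite comp_inL /= !comp_inL. Qed.

Lemma loc_bounded_bound T a : loc_bounded_op T ->
  exists c : R, 0 <= c /\ forall u, E a (lh_val u) -> nrm (lh_val (T u)) <= c * nrm (lh_val u).
Proof.
move=> [_ /(_ a)[_ _ [C hC]]]; have [c [c0 h]] := real_bound K K C.
by exists c; split=> // u /hC /h.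
Qed.

Lemma restr_alg T : A T -> forall a, comp_alg (D := D) (@restr T a).
Proof.
move=> [bT [Tp bTp TpE]] a; have [Tl _] := bT; apply: comp_algP.
- apply/bounded_opP; split.
    by move=> k x y; apply: val_inj; rewrite /= !restrE// inL_lin Tl.
  have [c [c0 hc]] := loc_bounded_bound a bT; exists c; split=> // x.
  rewrite -nrm_val restrE// -(nrm_val x) -(comp_inL x); rewrite comp_inL.
  by rewrite -[X in _ <= _ * nrm X]comp_inL; apply: hc; rewrite comp_inL; exact: (subH_in x).
(* Checked fibrewise: at almost every [p] the cut vector has the value [x(p)] or [0], and the linear
   operator [Tp p] sends [0] to [0]. *)
- move=> B mB x; apply: (di_ext (comp_di D a)).
  set y := dicut _ _ x; set u := inL (ldi_sys D) (sval_of x).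
  pose v := inL (ldi_sys D) (sval_of y).
  have hy := dicutE (comp_di D a) x mB.
  have hTx := dicutE (comp_di D a) (restr T x) mB.
  have ey := comp_evE y; have ex := comp_evE x.
  have eTy := comp_evE (restr T y); have eTx := comp_evE (restr T x).
  rewrite restrE// in eTy; rewrite restrE// in eTx.
  have hu := TpE u; have hv := TpE v.
  rewrite comp_inL in hu; rewrite comp_inL in hv.
  near=> p.
  rewrite (_ : comp_ev (dicut (comp_di D a) B (restr T x)) p =
    if p \in B then comp_ev (restr T x) p else 0); last by near: p.
  have -> : comp_ev (restr T y) p = ldi_ev (lh_val (T v)) p by near: p.
  have -> : comp_ev (restr T x) p = ldi_ev (lh_val (T u)) p by near: p.
  have [w wE ->] : exists2 w, lh_val w = ldi_ev (sval_of x) p &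
      ldi_ev (lh_val (T u)) p = lh_val (Tp p w) by near: p.
  have [w' w'E ->] : exists2 w, lh_val w = ldi_ev (sval_of y) p &
      ldi_ev (lh_val (T v)) p = lh_val (Tp p w) by near: p.
  have : ldi_ev (sval_of y) p = if p \in B then ldi_ev (sval_of x) p else 0.
    have <- : comp_ev y p = ldi_ev (sval_of y) p by near: p.
    have <- : comp_ev x p = ldi_ev (sval_of x) p by near: p.
    by near: p.
  rewrite -w'E -wE; case: ifP => _ h; first by rewrite (lh_inj (h : lh_val w' = lh_val w)).
  have [Tpl _] := bTp p; rewrite (lh_inj (h : lh_val w' = lh_val 0)).
  have := Tpl (-1) 0 0; rewrite !scaleN1r oppr0 addr0 addNr => ->.
  by [].
(* [T] preserves [E c] and its complement, so it carries the orthogonal decomposition of [x] to that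
   of [T x]. *)
- move=> c ca x; apply: val_inj => /=; rewrite cprojE// !restrE// cprojE//.
  have [_ /(_ c)[h1 h2 _]] := bT.
  apply/esym/oproj_unique.
    apply: h1; rewrite (inLK (a := c)); exact: oproj_in.
  set u := inL _ (sval_of x); set v := inL _ (oproj _ _).
  have -> : lh_val (T u) - lh_val (T v) = lh_val (T (u - v)).
    by rewrite addrC -scaleN1r -[u - v]addrC -(scaleN1r v) Tl.
  apply: h2 => /=; rewrite comp_inL (inLK (a := c)); last exact: oproj_in.
  exact: (oproj_perp (S := E c)).
Unshelve. all: by end_near. Qed.

Lemma restr_limit T : A T -> proj_limit (S := comp_system D) (@restr T).
Proof.
move=> AT; split; first exact: restr_alg.
move=> a b ab; apply/funext => x; apply: val_inj.
have [bT _] := AT.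
by rewrite /= (comp_resE x ab)//; [rewrite !restrE// inclE|exact: restr_alg].
Qed.

Lemma restr_inj T U : A T -> A U -> @restr T = @restr U -> T = U.
Proof.
move=> [bT _] [bU _] h; apply/funext => u; apply: lh_inj.
by have [a Ea] := lh_in u; rewrite -(restr_toE bT Ea) h restr_toE.
Qed.

(** The [z a] are glued over the global space, and [limit_decomposable] supplies the fibres of the
    result. *)
Lemma restr_surj (z : forall a, G a -> G a) : proj_limit (S := comp_system D) z ->
  exists2 T, A T & @restr T = z.
Proof.
move=> [/= zalg zres].
have zb := fun a => comp_alg_bound (zalg a).
have [|||||T [bT TE]] := @glue_exists _ _ _ _ (ldi_sys D) (fun a h => sval_of (z a (toE a h))).
- by move=> a v _; exact: (subH_in (z a (toE a v))).
- move=> a k v w Ev Ew.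
  have -> : toE a (k *: v + w) = k *: toE a v + toE a w.
    by apply: val_inj; rewrite /= !toEK//; exact: (csP (c := E a)).
  by rewrite (zb a).1.
- move=> a; have [_ [c [_ hc]]] := zb a; exists c => v Ev.
  by have := hc (toE a v); rewrite -[X in _ <= _ * X -> _]nrm_val toEK.
- move=> a b v ab Ev; have := limit_val zalg zres (toE a v) ab.
  by rewrite toEK.
- move=> a b v ab Ev; have h := comp_alg_proj (zalg b) ab (toE b v).
  rewrite -[LHS]cprojE// -h; congr (sval_of (z b _)).
  by apply: val_inj; rewrite /= cprojE// toEK// toEK//; apply: (comp_mono ab); exact: oproj_in.
exists T; first by split => //; exact: (limit_decomposable mu_complete ae_forall zalg zres).
apply: functional_extensionality_dep => a; apply/funext => x; apply: val_inj.
rewrite /= restrE// (TE a); last by rewrite comp_inL; exact: (subH_in x).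
by rewrite comp_inL toE_val.
Qed.

(** The unit ball of [G a] corresponds to the vectors over which the seminorm is taken, with the
    same norms. The two topologies therefore coincide seminorm by seminorm. *)
Lemma seminorm_restr T U a : A T -> A U ->
  loc_seminorm (E := ldi_sys D) a (U - T) = opnorm (@restr U a - @restr T a).
Proof.
move=> [bT _] [bU _]; rewrite /loc_seminorm /opnorm; congr sup.
apply/seteqP; split => [_ [u /= [Eu u1] <-]|_ [x /= x1 <-]].
- exists (toE a (lh_val u)) => /=.
    by rewrite subH_normE toEK.
  by rewrite subH_normE /= !restr_toE.
- exists (inL (ldi_sys D) (sval_of x)) => /=.
    by rewrite comp_inL; split=> //; exact: (subH_in x).
  by rewrite subH_normE /= !restrE.
Qed.

Theorem decomposable_loc_vN : loc_von_neumann_algebra A.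
Proof.
exists d, L, (comp_system D), (fun T a => @restr T a); split.
- split.
  + by move=> T; exact: restr_limit.
  + by move=> T U /set_mem AT /set_mem AU; exact: restr_inj.
  + by move=> z /restr_surj[T AT <-]; exists T.
- move=> k T U [bT _] [bU _] a; apply/funext => x; apply: val_inj.
  rewrite /restr /=.
  have [_ /(_ a)[hT _ _]] := bT; have [_ /(_ a)[hU _ _]] := bU.
  have Ex : ldi_sys D a (lh_val (inL (ldi_sys D) (sval_of x))).
    by rewrite comp_inL; exact: (subH_in x).
  by rewrite !toEK//; [exact: hU|exact: hT|apply: (csP (c := E a)); [exact: hT|exact: hU]].
- move=> T U [bT _] [bU _] a; apply/funext => x; apply: val_inj.
  rewrite /= (restrE _ bT) (restrE _ bU) lh_valK /restr /= toEK//.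
  have [_ /(_ a)[hT _ _]] := bT; have [_ /(_ a)[hU _ _]] := bU.
  by apply: hT; apply: hU; rewrite comp_inL; exact: (subH_in x).
- move=> T U [bT _] [bU _]; split.
    move=> TU a x y; rewrite !subH_dotpE !restrE//.
    by have := TU (inL _ (sval_of x)) (inL _ (sval_of y)); rewrite !comp_inL.
  move=> TU u v; have [a Ea] := lh_in u; have [b Eb] := lh_in v.
  have [c [ac bc]] := directed_ub a b.
  have := TU c (toE c (lh_val u)) (toE c (lh_val v)).
  have Ecu := ind_mono ac Ea; have Ecv := ind_mono bc Eb.
  by rewrite !subH_dotpE !restr_toE// !toEK.
- move=> F FF FA T AT.
  have eqF a : \forall U \near F, loc_seminorm (E := ldi_sys D) a (U - T) =
      opnorm (@restr U a - @restr T a).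
    by apply: filterS FA => U AU; exact: seminorm_restr.
  split => h a.
    by apply: cvg_trans (h a); apply: near_eq_cvg; exact: eqF.
  by apply: cvg_trans (h a); apply: near_eq_cvg; apply: filterS (eqF a) => U.
Qed.

End Isomorphism.

Theorem theorem3p3 (R : realType) (d : Order.disp_t) (L : directedType d)
    (X : ptopologicalType)
    (hX1 : sigma_compact X) (hX2 : locally_compact [set: X])
    (nu : {measure set (borelType X) -> \bar R})
    (mu : {measure set (completedType nu) -> \bar R})
    (hmu : is_completion mu)
    (Q : completedType nu -> quantized_domain R L)
    (hQ : forall p, separable (Q p))
    (D : loc_direct_integral mu Q) :
  countable [set: L] \/ is_counting mu ->
  loc_von_neumann_algebra (decomposable_algebra (D := D)).
Proof.
move=> hL; apply: decomposable_loc_vN; first exact: completion_complete.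
move=> P hP; case: hL => [cL|cmu]; first exact: ae_forall_countable.
by apply: nearW => p a; exact: ae_counting (hP a) p.
Qed.
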